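(* Let $p$ be a prime and let $G$ and $H$ be finite $p$-groups such that the group algebras $\mathbb{F}_p G$ and $\mathbb{F}_p H$ are isomorphic (as $\mathbb{F}_p$-algebras). If $G$ is a 2-generated group of nilpotence class at most 2, then $G\cong H$.
   Context: $\mathbb{F}_p$ denotes the field with $p$ elements, and $\mathbb{F}_pG$ is the group algebra of $G$ with coefficients in $\mathbb{F}_p$. A group is 2-generated if it can be generated by two elements. *)

(* Defs.v *)
From HB Require Import structures.
From mathcomp Require Import all_boot all_order all_algebra.
From mathcomp Require Import all_fingroup all_solvable.

Set Implicit Arguments.
Unset Strict Implicit.
Unset Printing Implicit Defensive.

Import GroupScope GRing.Theory.

Local Open Scope ring_scope.

(* The element \sum_x a_x x of the group algebra is encoded by its coefficient
   function x |-> a_x.  The name galg R gT keeps the convolution product apart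
   from the pointwise product that {ffun gT -> R} already carries. *)
Definition galg (R : comNzRingType) (gT : finGroupType) := {ffun gT -> R}.

Section GroupAlgebra.

Variables (R : comNzRingType) (gT : finGroupType).

HB.instance Definition _ := GRing.Zmodule.copy (galg R gT) {ffun gT -> R}.

Implicit Types f g h : galg R gT.

Definition galg_one : galg R gT := [ffun x => (x == 1%g)%:R].

(* The terms of this sum are the products f y * g z with y z = x. *)
Definition galg_mul f g : galg R gT :=
  [ffun x => \sum_(y : gT) f y * g (y^-1 * x)%g].

Definition galg_scale (a : R) f : galg R gT := [ffun x => a * f x].

Lemma galg_addE f g x : (f + g) x = f x + g x.
Proof. by rewrite ffunE. Qed.

Fact galg_mulA : associative galg_mul.
Proof.
move=> f g h; apply/ffunP=> x; rewrite !ffunE.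
under eq_bigr => y _ do rewrite ffunE big_distrr /=.
under [RHS]eq_bigr => z _ do rewrite ffunE big_distrl /=.
rewrite [RHS]exchange_big /=; apply: eq_bigr => y _.
rewrite [RHS](reindex_inj (mulgI y)) /=; apply: eq_bigr => z _.
by rewrite mulrA mulKg invMg mulgA.
Qed.

Fact galg_mul1l : left_id galg_one galg_mul.
Proof.
move=> f; apply/ffunP=> x; rewrite ffunE (bigD1 1%g) //= !ffunE eqxx mul1r.
rewrite invg1 mul1g big1 ?addr0 // => y /negbTE y1.
by rewrite ffunE y1 mul0r.
Qed.

Fact galg_mul1r : right_id galg_one galg_mul.
Proof.
move=> f; apply/ffunP=> x; rewrite ffunE (bigD1 x) //= !ffunE mulVg eqxx mulr1.
rewrite big1 ?addr0 // => y /negbTE yx.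
by rewrite ffunE -eq_mulVg1 yx mulr0.
Qed.

Fact galg_mulDl : left_distributive galg_mul +%R.
Proof.
move=> f g h; apply/ffunP=> x; rewrite !ffunE -big_split /=.
by apply: eq_bigr => y _; rewrite galg_addE mulrDl.
Qed.

Fact galg_mulDr : right_distributive galg_mul +%R.
Proof.
move=> f g h; apply/ffunP=> x; rewrite !ffunE -big_split /=.
by apply: eq_bigr => y _; rewrite galg_addE mulrDr.
Qed.

Fact galg_oner_neq0 : galg_one != 0.
Proof.
by apply/eqP => /ffunP/(_ 1%g)/eqP; rewrite !ffunE eqxx oner_eq0.
Qed.

HB.instance Definition _ := GRing.Zmodule_isNzRing.Build (galg R gT)
  galg_mulA galg_mul1l galg_mul1r galg_mulDl galg_mulDr galg_oner_neq0.

Fact galg_scaleA a b f : galg_scale a (galg_scale b f) = galg_scale (a * b) f.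
Proof. by apply/ffunP=> x; rewrite !ffunE mulrA. Qed.

Fact galg_scale1 : left_id 1 galg_scale.
Proof. by move=> f; apply/ffunP=> x; rewrite !ffunE mul1r. Qed.

Fact galg_scaleDr : right_distributive galg_scale +%R.
Proof. by move=> a f g; apply/ffunP=> x; rewrite !ffunE mulrDr. Qed.

Fact galg_scaleDl f : {morph galg_scale^~ f : a b / a + b}.
Proof. by move=> a b; apply/ffunP=> x; rewrite !ffunE mulrDl. Qed.

HB.instance Definition _ := GRing.Zmodule_isLmodule.Build R (galg R gT)
  galg_scaleA galg_scale1 galg_scaleDr galg_scaleDl.

Fact galg_scaleAl (a : R) f g : a *: (f * g) = (a *: f) * g.
Proof.
apply/ffunP=> x; rewrite !ffunE big_distrr /=.
by apply: eq_bigr => y _; rewrite ffunE mulrA.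
Qed.

HB.instance Definition _ :=
  GRing.Lmodule_isLalgebra.Build R (galg R gT) galg_scaleAl.

Fact galg_scaleAr (a : R) f g : a *: (f * g) = f * (a *: g).
Proof.
apply/ffunP=> x; rewrite !ffunE big_distrr /=.
by apply: eq_bigr => y _; rewrite ffunE mulrCA.
Qed.

HB.instance Definition _ :=
  GRing.Lalgebra_isAlgebra.Build R (galg R gT) galg_scaleAr.

End GroupAlgebra.

Definition alg_isomorphic (R : comNzRingType) (A B : algType R) : Prop :=
  exists f : {lrmorphism A -> B}, bijective f.

(* The two generators may coincide or be trivial, so cyclic groups qualify. *)
Definition two_generated (gT : finGroupType) (G : {group gT}) : Prop :=
  exists x y : gT, G :=: <<[set x; y]>>%g.

(* Main.v *)
From HB Require Import structures.
Require Import Defs.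
From mathcomp Require Import all_boot all_order all_algebra.
From mathcomp Require Import all_fingroup all_solvable.
From mathcomp Require Import finfield zify ring.
Set Implicit Arguments.
Unset Strict Implicit.
Unset Printing Implicit Defensive.
Import GroupScope GRing.Theory.

(** Let a and b generate G and let c = [~ a, b]. Then c is central, and G is
    given by relations a^(p^m) = c^i, b^(p^n) = c^j, c^(p^r) = 1, where the
    abelianization of G has type (p^m, p^n) with r <= n <= m and G' = <c> has
    order p^r. Groups with the same parameters are isomorphic
    ([class2_pair_isog]), and a change of generators turns (i, j) into a pair
    (p^s, p^t) with (s, t) in an explicit list ([has_pair_normal],
    [exceptional_normal]). So it is enough to recover m, n, r, s and t from the
    algebra FG.

    The tool is the p^k-power map modulo commutators. A linear form phi with
    phi (x y) = phi (y x) satisfies phi (x^(p^k)) = \sum_g x_g phi (g^(p^k))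
    ([trace_pow]), since the words in the expansion of x^(p^k) that are not
    constant cancel along the orbits of rotation. Hence the vanishing at
    x^(p^k) of all forms of a certain kind, a property that isomorphisms
    preserve, is a statement about p^k-th powers in G. The forms that vanish on
    the ideal K generated by commutators give the type of the abelianization
    ([card_comm_null1]); applied to the central element c - 1 and to its powers,
    these ideas show that H has class at most 2 as well ([iso_class2]). All
    trace forms together give the exponent of G, and those that vanish on
    K^(p^l) tell whether two p^n-th powers that agree modulo G' agree modulo
    <c^(p^l)>, which means l <= min (s, t) ([comm_null_power_sep],
    [c2_power_sep]). The exponent and min (s, t) determine (s, t)
    ([normal_exps_inj]).

    That argument needs the p^n-power map to be multiplicative modulo
    <c^(p^l)>. For l = r this fails exactly when p = 2 and n = r > 0, and then
    two candidates remain: (s, t) = (r, r) or (r, r - 1) if n < m, and two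
    groups that generalize D_8 and Q_8 if n = m. They are separated by computing
    x^(2^r) itself, and not only modulo commutators, up to (w - 1) I, where w is
    the involution of G' and I is the augmentation ideal: besides a part linear
    in x, there is a quadratic form in the coordinates of x modulo 2
    ([pow2_upow]). *)

(** * Two generators with a central commutator *)

Section NormalForm.

Variables (gT : finGroupType) (u v : gT) (P Q R i j : nat).
Let w := [~ u, v].
Hypotheses (cuw : commute u w) (cvw : commute v w).
Hypotheses (P_gt0 : 0 < P) (Q_gt0 : 0 < Q) (R_gt0 : 0 < R).
Hypotheses (uP : u ^+ P = w ^+ i) (vQ : v ^+ Q = w ^+ j) (wR : w ^+ R = 1).

Lemma normal_form_reduce x y z :
  exists z' : 'I_R, u ^+ x * v ^+ y * w ^+ z
             = u ^+ (x %% P) * v ^+ (y %% Q) * w ^+ z'.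
Proof.
pose e := (i * (x %/ P) + (j * (y %/ Q) + z))%N.
exists (Ordinal (ltn_pmod e R_gt0)) => /=.
have -> : u ^+ x = u ^+ (x %% P) * w ^+ (i * (x %/ P)).
  by rewrite {1}(divn_eq x P) addnC expgD mulnC !expgM uP.
have -> : v ^+ y = v ^+ (y %% Q) * w ^+ (j * (y %/ Q)).
  by rewrite {1}(divn_eq y Q) addnC expgD mulnC !expgM vQ.
rewrite (expg_mod _ wR) !expgD -!mulgA; congr (_ * _); rewrite !mulgA.
by congr (_ * _ * _); apply/commuteX/commute_sym/commuteX.
Qed.

(** Moving u to the left past v^y costs w^-y. Writing w^-1 as w^R.-1 keeps all
    exponents natural. *)
Lemma normal_form g : g \in <<[set u; v]>> ->
  exists x y z : nat, g = u ^+ x * v ^+ y * w ^+ z.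
Proof.
have cu k : commute u (w ^+ k) by apply: commuteX.
have cv k : commute v (w ^+ k) by apply: commuteX.
have vyu y : v ^+ y * u = u * v ^+ y * w ^+ (R.-1 * y).
  rewrite commgC; congr (_ * _).
  have cv' : commute v [~ v, u] by rewrite -invg_comm; apply: commuteV.
  rewrite commXg // -invg_comm -/w expgM.
  have ->// : w^-1 = w ^+ R.-1.
  by apply: (mulgI w); rewrite mulgV -expgS prednK.
case/gen_prodgP=> n [f fP ->]; elim: n f fP => [|n IHn] f fP.
  by exists 0, 0, 0; rewrite big_ord0 !expg0 !mulg1.
rewrite big_ord_recr /=.
have [|x [y [z ->]]] := IHn (fun i => f (widen_ord (leqnSn n) i)).
  by move=> ?; apply: fP.
have /set2P[->|->] := fP ord_max.
  exists x.+1, y, (R.-1 * y + z).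
  by rewrite -mulgA -(cu z) mulgA -(mulgA _ _ u) vyu !mulgA -expgSr expgD !mulgA.
by exists x, y.+1, z; rewrite -mulgA -(cv z) mulgA -(mulgA _ _ v) -expgSr.
Qed.

Lemma normal_form_bounded g : g \in <<[set u; v]>> ->
  exists t : 'I_P * 'I_Q * 'I_R, g = u ^+ t.1.1 * v ^+ t.1.2 * w ^+ t.2.
Proof.
case/normal_form=> x [y [z ->]]; have [z' ->] := normal_form_reduce x y z.
by exists (Ordinal (ltn_pmod x P_gt0), Ordinal (ltn_pmod y Q_gt0), z').
Qed.

Let nf (t : 'I_P * 'I_Q * 'I_R) := u ^+ t.1.1 * v ^+ t.1.2 * w ^+ t.2.

Lemma gen_sub_normal_forms : <<[set u; v]>> \subset nf @: [set: 'I_P * 'I_Q * 'I_R].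
Proof.
by apply/subsetP=> g /normal_form_bounded[t ->]; apply: imset_f; rewrite inE.
Qed.

Lemma card_gen_commutator : #|<<[set u; v]>>| <= P * Q * R.
Proof.
apply: leq_trans (subset_leq_card gen_sub_normal_forms) _.
by apply: leq_trans (leq_imset_card _ _) _; rewrite cardsT !card_prod !card_ord.
Qed.

(** A group of the largest possible order P Q R leaves no room for a coincidence
    among the P Q R normal forms. *)
Lemma normal_form_inj : #|<<[set u; v]>>| = (P * Q * R)%N -> injective nf.
Proof.
move=> cardG.
have /imset_injP inj :
    #|nf @: [set: 'I_P * 'I_Q * 'I_R]| == #|[set: 'I_P * 'I_Q * 'I_R]|.
  rewrite eqn_leq leq_imset_card cardsT !card_prod !card_ord -cardG.
  exact: subset_leq_card gen_sub_normal_forms.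
by move=> s t; apply: inj; rewrite inE.
Qed.

Lemma normal_form_dvd x y z : #|<<[set u; v]>>| = (P * Q * R)%N ->
  u ^+ x * v ^+ y = w ^+ z -> P %| x /\ Q %| y.
Proof.
move=> cardG /(congr1 (fun g => g * (w ^+ z)^-1)); rewrite mulgV.
rewrite -expVgn; have -> : w^-1 = w ^+ R.-1.
  by apply: (mulgI w); rewrite mulgV -expgS prednK.
rewrite -expgM; set z1 := (_ * z)%N; have [z2 ->] := normal_form_reduce x y z1.
have nf1 : nf (Ordinal P_gt0, Ordinal Q_gt0, Ordinal R_gt0) = 1.
  by rewrite /nf !expg0 !mulg1.
rewrite -nf1 => e.
have := @normal_form_inj cardG (Ordinal (ltn_pmod x P_gt0), Ordinal (ltn_pmod y Q_gt0), z2) _ e.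
by case=> /eqP x0 /eqP y0 _; split.
Qed.

End NormalForm.

(** A group of order p^(m+n+r) whose derived subgroup <[~ a, b]> has order p^r
    and whose abelianization is the direct product of the cyclic groups of
    orders p^m and p^n generated by the images of a and b. Only i and j modulo
    p^r matter. Fixing the order turns the relations into a presentation. *)
Record class2_pair (p m n r i j : nat) (gT : finGroupType) (a b : gT) : Prop :=
  Class2Pair {
    c2_gen : <<[set a; b]>> = [set: gT];
    c2_cent : forall g, commute g [~ a, b];
    c2_order : #[[~ a, b]] = (p ^ r)%N;
    c2_powa : a ^+ (p ^ m) = [~ a, b] ^+ i;
    c2_powb : b ^+ (p ^ n) = [~ a, b] ^+ j;
    c2_card : #|[set: gT]| = (p ^ m * p ^ n * p ^ r)%N }.

(** The subgroup of the direct product generated by (a, a') and (b, b')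
    satisfies the same relations, so its order is at most p^(m+n+r). It projects
    onto both factors, so both projections are isomorphisms. *)
Lemma class2_pair_isog p m n r i j (gT hT : finGroupType) (a b : gT) (a' b' : hT) :
    0 < p -> class2_pair p m n r i j a b -> class2_pair p m n r i j a' b' ->
  [set: gT] \isog [set: hT].
Proof.
move=> p_gt0 [genG cG oG aG bG cardG] [genH cH oH aH bH cardH].
pose u := (a, a'); pose v := (b, b'); pose D := <<[set u; v]>>.
have uv : [~ u, v] = ([~ a, b], [~ a', b']) by [].
have powp k (x : gT) (y : hT) : ((x, y) : gT * hT) ^+ k = (x ^+ k, y ^+ k).
  by elim: k => // k IHk; rewrite !expgS IHk.
have leD : #|D| <= p ^ m * p ^ n * p ^ r.
  apply: (@card_gen_commutator _ u v (p ^ m) (p ^ n) (p ^ r) i j); rewrite ?expn_gt0 ?p_gt0 //.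
  - by rewrite uv; congr (_, _); [apply: cG | apply: cH].
  - by rewrite uv; congr (_, _); [apply: cG | apply: cH].
  - by rewrite uv !powp aG aH.
  - by rewrite uv !powp bG bH.
  by rewrite uv powp -{1}oG -oH !expg_order.
have imD1 : (@fst gT hT) @* D = [set: gT].
  by rewrite morphim_gen ?subsetT // morphimEsub ?subsetT // imsetU1 imset_set1.
have imD2 : (@snd gT hT) @* D = [set: hT].
  by rewrite morphim_gen ?subsetT // morphimEsub ?subsetT // imsetU1 imset_set1.
have homG : homg [set: gT] D by rewrite -imD1 morphim_homg ?subsetT.
have homH : homg [set: hT] D by rewrite -imD2 morphim_homg ?subsetT.
have isoG : [set: gT] \isog D by rewrite isogEcard homG cardG.
have isoH : [set: hT] \isog D by rewrite isogEcard homH cardH.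
by rewrite (isog_transl _ isoG) isog_sym.
Qed.

Definition has_pair p m n r i j (gT : finGroupType) :=
  exists a b : gT, class2_pair p m n r i j a b.

Lemma has_pair_isog p m n r i j (gT hT : finGroupType) : 0 < p ->
  has_pair p m n r i j gT -> has_pair p m n r i j hT -> [set: gT] \isog [set: hT].
Proof. by move=> p_gt0 [a [b D]] [a' [b' D']]; apply: class2_pair_isog p_gt0 D D'. Qed.

Section Class2Pair.

Variables (p m n r i j : nat) (gT : finGroupType) (a b : gT).
Hypotheses (p_gt0 : 0 < p) (D : class2_pair p m n r i j a b).
Let c := [~ a, b].
(** This plays the role of -1 in the exponents of c. *)
Let N := (p ^ r).-1.

Lemma c2_centX k g : commute g (c ^+ k).
Proof. exact/commuteX/(c2_cent D). Qed.

Lemma c2_exp : c ^+ (p ^ r) = 1.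
Proof. by rewrite -(c2_order D) expg_order. Qed.

Lemma c2_eq_exp k l : (c ^+ k == c ^+ l) = (k == l %[mod p ^ r]).
Proof. by rewrite eq_expg_mod_order (c2_order D). Qed.

Lemma c2_invX k : (c ^+ k)^-1 = c ^+ (N * k).
Proof.
rewrite -expVgn expgM; congr (_ ^+ k); apply: (mulgI c).
by rewrite mulgV -expgS prednK ?expn_gt0 ?p_gt0 // c2_exp.
Qed.

Lemma c2_commXX x y : [~ a ^+ x, b ^+ y] = c ^+ (x * y).
Proof. by rewrite commXXg //; apply: c2_cent D _. Qed.

Lemma c2_commXXV x y : [~ b ^+ y, a ^+ x] = c ^+ (N * (x * y)).
Proof. by rewrite -invg_comm c2_commXX c2_invX. Qed.

Lemma c2_commbX y : [~ b ^+ y, a] = c ^+ (N * y).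
Proof. by have := c2_commXXV 1 y; rewrite expg1 mul1n. Qed.

Lemma c2_commaX x : [~ a ^+ x, b] = c ^+ x.
Proof. by have := c2_commXX x 1; rewrite expg1 muln1. Qed.

Lemma c2_mul x y z x' y' z' :
  (a ^+ x * b ^+ y * c ^+ z) * (a ^+ x' * b ^+ y' * c ^+ z')
  = a ^+ (x + x') * b ^+ (y + y') * c ^+ (z + z' + N * (x' * y)).
Proof.
rewrite -[LHS]mulgA [c ^+ z * _]mulgA -[c ^+ z * _](c2_centX z) -!mulgA -expgD.
rewrite [b ^+ y * _]mulgA [b ^+ y * _]commgC c2_commXXV.
rewrite -!mulgA [c ^+ _ * (_ * _)]mulgA -[c ^+ _ * b ^+ y'](c2_centX (N * (x' * y))).
by rewrite -!mulgA -expgD !mulgA -!expgD -[_ * b ^+ y * _]mulgA -expgD [(N * _ + _)%N]addnC.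
Qed.

Lemma c2_normal_form g : exists x y z : nat, g = a ^+ x * b ^+ y * c ^+ z.
Proof.
apply: (@normal_form gT a b (p ^ r)); rewrite ?expn_gt0 ?p_gt0 ?(c2_gen D) ?inE //;
  by [apply: c2_cent D _ | apply: c2_exp].
Qed.

Lemma c2_comm_normal_form x y z x' y' z' :
  [~ a ^+ x * b ^+ y * c ^+ z, a ^+ x' * b ^+ y' * c ^+ z']
  = c ^+ (x * y' + N * (x' * y)).
Proof.
set g := _ * c ^+ z; set h := _ * c ^+ z'.
have gh : g * h = a ^+ (x + x') * b ^+ (y + y') * c ^+ (z + z' + N * (x' * y)).
  exact: c2_mul.
have hg : h * g = a ^+ (x + x') * b ^+ (y + y') * c ^+ (z + z' + N * (x * y')).
  by rewrite /h /g c2_mul [(x' + x)%N]addnC [(y' + y)%N]addnC [(z' + z)%N]addnC.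
apply: (mulgI (h * g)); rewrite -commgC gh hg -[RHS]mulgA -expgD; congr (_ * _).
apply/eqP; rewrite c2_eq_exp; apply/eqP.
have -> : (z + z' + N * (x * y') + (x * y' + N * (x' * y))
  = x * y' * N.+1 + (z + z' + N * (x' * y)))%N by nia.
by rewrite prednK ?expn_gt0 ?p_gt0 // modnMDl.
Qed.

Lemma c2_comm_mem g h : exists e, [~ g, h] = c ^+ e.
Proof.
have [x [y [z ->]]] := c2_normal_form g; have [x' [y' [z' ->]]] := c2_normal_form h.
by rewrite c2_comm_normal_form; eexists.
Qed.

(** The correction to multiplicativity is the power C(e, 2) of a commutator. *)
Lemma c2_expM (g h : gT) e : p ^ r %| 'C(e, 2) -> (g * h) ^+ e = g ^+ e * h ^+ e.
Proof.
move=> dvd; have [l hl] := c2_comm_mem h g.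
rewrite expMg_Rmul hl; try exact: c2_centX.
rewrite -expgM (_ : c ^+ _ = 1) ?mulg1 //; apply/eqP.
by rewrite -order_dvdn (c2_order D) dvdn_mull.
Qed.

Lemma c2_dvd x y z : a ^+ x * b ^+ y = c ^+ z -> p ^ m %| x /\ p ^ n %| y.
Proof.
apply: (@normal_form_dvd gT a b (p ^ m) (p ^ n) (p ^ r) i j); rewrite ?expn_gt0 ?p_gt0 //.
- exact: c2_cent D _.
- exact: c2_cent D _.
- exact: c2_powa D.
- exact: c2_powb D.
- exact: c2_exp.
by rewrite (c2_gen D) (c2_card D).
Qed.

Lemma c2_reduce x y z : exists z' : 'I_(p ^ r),
  a ^+ x * b ^+ y * c ^+ z = a ^+ (x %% p ^ m) * b ^+ (y %% p ^ n) * c ^+ z'.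
Proof.
apply: (@normal_form_reduce gT a b (p ^ m) (p ^ n) (p ^ r) i j).
- exact: c2_cent D _.
- by rewrite expn_gt0 p_gt0.
- exact: c2_powa D.
- exact: c2_powb D.
exact: c2_exp.
Qed.

Lemma c2_normal_form_mod x y z x' y' z' :
    a ^+ x * b ^+ y * c ^+ z = a ^+ x' * b ^+ y' * c ^+ z' ->
  x = x' %[mod p ^ m] /\ y = y' %[mod p ^ n].
Proof.
have P_gt0 k : 0 < p ^ k by rewrite expn_gt0 p_gt0.
have [z1 ->] := c2_reduce x y z; have [z2 ->] := c2_reduce x' y' z'.
pose t1 := (Ordinal (ltn_pmod x (P_gt0 m)), Ordinal (ltn_pmod y (P_gt0 n)), z1).
pose t2 := (Ordinal (ltn_pmod x' (P_gt0 m)), Ordinal (ltn_pmod y' (P_gt0 n)), z2).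
have cardG : #|<<[set a; b]>>| = (p ^ m * p ^ n * p ^ r)%N.
  by rewrite (c2_gen D) (c2_card D).
have inj := normal_form_inj (c2_cent D a) (c2_cent D b) (P_gt0 m) (P_gt0 n) (P_gt0 r)
  (c2_powa D) (c2_powb D) c2_exp cardG.
by move=> e; case: (inj t1 t2 e).
Qed.

Lemma c2_congr i' j' : i = i' %[mod p ^ r] -> j = j' %[mod p ^ r] ->
  class2_pair p m n r i' j' a b.
Proof.
move=> ei ej; split; try by case: D.
  by rewrite (c2_powa D); apply/eqP; rewrite c2_eq_exp; apply/eqP.
by rewrite (c2_powb D); apply/eqP; rewrite c2_eq_exp; apply/eqP.
Qed.

Lemma c2_genT (a' b' : gT) : a \in <<[set a'; b']>> -> b \in <<[set a'; b']>> ->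
  <<[set a'; b']>> = [set: gT].
Proof.
move=> a_in b_in; apply/eqP; rewrite eqEsubset subsetT -(c2_gen D) gen_subG.
by rewrite subUset !sub1set a_in.
Qed.

(** Expanding (a b^k)^(p^m) moves every b^k past the later factors a, hence the
    binomial coefficient. *)
Lemma c2_change_a k : n <= m ->
  class2_pair p m n r (i + k * (j * p ^ (m - n) + N * 'C(p ^ m, 2))) j (a * b ^+ k) b.
Proof.
move=> le_nm.
have ec : [~ a * b ^+ k, b] = c.
  rewrite commMgJ (_ : [~ b ^+ k, b] = 1) ?mulg1.
    by rewrite /conjg -(c2_centX 1) mulKg.
  exact/eqP/commgP/commute_sym/commuteX.
split; rewrite ?ec; try by case: D.
- have b_in : b \in <<[set a * b ^+ k; b]>> by rewrite mem_gen ?set22.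
  by apply: c2_genT => //; rewrite -(groupMr a (groupX k b_in)) mem_gen ?set21.
rewrite expMg_Rmul c2_commbX; try exact: c2_centX.
rewrite (c2_powa D) -[b ^+ k ^+ _]expgM.
rewrite (_ : (k * p ^ m = p ^ n * (k * p ^ (m - n)))%N); last first.
  by rewrite mulnCA -expnD subnKC.
rewrite expgM (c2_powb D) -!expgM -!expgD; congr (_ ^+ _); nia.
Qed.

(** The exponent of a is a multiple of p^(m - n) so that the new b keeps order
    p^n modulo the derived subgroup. *)
Lemma c2_change_b k : n <= m ->
  class2_pair p m n r i (j + k * (i + p ^ (m - n) * 'C(p ^ n, 2)))
     a (b * a ^+ (k * p ^ (m - n))).
Proof.
move=> le_nm; set K := (k * p ^ (m - n))%N.
have ec : [~ a, b * a ^+ K] = c.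
  rewrite commgMJ (_ : [~ a, a ^+ K] = 1) ?mul1g.
    by rewrite /conjg -(c2_centX 1) mulKg.
  exact/eqP/commgP/commuteX.
split; rewrite ?ec; try by case: D.
- have a_in : a \in <<[set a; b * a ^+ K]>> by rewrite mem_gen ?set21.
  by apply: c2_genT => //; rewrite -(groupMr b (groupX K a_in)) mem_gen ?set22.
rewrite expMg_Rmul c2_commaX; try exact: c2_centX.
rewrite (c2_powb D) -[a ^+ K ^+ _]expgM.
rewrite (_ : (K * p ^ n = p ^ m * k)%N); last first.
  by rewrite /K -mulnA -expnD subnK // mulnC.
rewrite expgM (c2_powa D) -!expgM -!expgD; congr (_ ^+ _); rewrite /K; nia.
Qed.

(** The commutator is raised to the power x z, so i is in effect divided by z
    and j by x. This is how the unit parts of i and j are removed. *)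
Lemma c2_scale x z i' j' : prime p -> coprime p x -> coprime p z ->
    i * x = i' * (x * z) %[mod p ^ r] -> j * z = j' * (x * z) %[mod p ^ r] ->
  class2_pair p m n r i' j' (a ^+ x) (b ^+ z).
Proof.
move=> p_pr cx cz ei ej.
have ec : [~ a ^+ x, b ^+ z] = c ^+ (x * z) by apply: c2_commXX.
have co (g : gT) y : coprime p y -> g \in <[g ^+ y]>.
  move=> cy; suff /eqP<- : generator <[g]> (g ^+ y) by apply: cycle_id.
  rewrite generator_coprime; apply: coprime_dvdl (_ : _ %| p ^ (m + n + r)) _.
    by rewrite !expnD -(c2_card D) order_dvdG ?inE.
  exact: coprimeXl.
split; rewrite ?ec; try by case: D.
- apply: c2_genT.
    by apply: (subsetP _ _ (co a x cx)); rewrite cycle_subG mem_gen ?set21.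
  by apply: (subsetP _ _ (co b z cz)); rewrite cycle_subG mem_gen ?set22.
- move=> g; apply: c2_centX.
- rewrite orderXgcd (c2_order D) (eqP (_ : coprime _ _)) ?divn1 //.
  by rewrite coprimeXl // coprimeMr cx.
- rewrite -expgM mulnC expgM (c2_powa D) -!expgM; apply/eqP; rewrite c2_eq_exp.
  by rewrite ei mulnC.
rewrite -expgM mulnC expgM (c2_powb D) -!expgM; apply/eqP; rewrite c2_eq_exp.
by rewrite ej mulnC.
Qed.

End Class2Pair.

(** * Arithmetic modulo a prime power *)

Section ModularArithmetic.

Local Open Scope nat_scope.

Variables (p r : nat).
Hypothesis p_pr : prime p.

Lemma unit_pow_split i : exists s u, [/\ s <= r, coprime p u & i = u * p ^ s %[mod p ^ r]].
Proof.
have [r_dvd|nr_dvd] := boolP (p ^ r %| i).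
  by exists r, 1%N; rewrite coprimen1 mul1n modnn (eqP r_dvd).
have i_gt0 : 0 < i by case: i nr_dvd => //; rewrite dvdn0.
have [u cpu ei] := pfactor_coprime p_pr i_gt0.
exists (logn p i), u; split=> //; last by rewrite -ei.
rewrite leqNgt; apply: contra nr_dvd => lt_r; rewrite ei dvdn_mull //.
by rewrite dvdn_exp2l // ltnW.
Qed.

Lemma inverse_mod u : coprime p u -> exists k, k * u = 1%N %[mod p ^ r].
Proof.
move=> cpu; have u_gt0 : 0 < u.
  by case: u cpu => //; rewrite /coprime gcdn0 => /eqP p1; move: p_pr; rewrite p1.
have /(coprimeP (p ^ r) u_gt0)[[k l] /= e] : coprime u (p ^ r).
  by rewrite coprime_sym coprimeXl.
exists k; have -> : (k * u = l * p ^ r + 1)%N by lia.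
by rewrite modnMDl.
Qed.

Lemma solve_mod u v : coprime p u -> exists k, p ^ r %| v + k * u.
Proof.
case/inverse_mod=> k ek; exists ((p ^ r).-1 * v * k).
have pr_gt0 : 0 < p ^ r by rewrite expn_gt0 prime_gt0.
rewrite -mulnA /dvdn -modnDmr -modnMmr ek modnMmr muln1 modnDmr.
by rewrite -mulSn prednK // modnMr.
Qed.

(** Since 2 C(q, 2) = q (q - 1), dividing by 2 only matters for p = 2, where it
    costs one factor p. *)
Lemma bin2_pow_dvd e : r <= e -> [|| odd p, r < e | r == 0] -> p ^ r %| 'C(p ^ e, 2).
Proof.
have e2 : (p ^ e * (p ^ e).-1 = 2 * 'C(p ^ e, 2))%N.
  by rewrite -[in LHS](bin1 (p ^ e).-1) mul_bin_diag.
move=> le_re; have [p2|odd_p _] := even_prime p_pr; last first.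
  rewrite -(@Gauss_dvdr _ 2); last by rewrite coprimeXl // coprimen2.
  by rewrite -e2 dvdn_mulr // dvdn_exp2l.
rewrite p2 /= in e2 *; case/orP=> [lt_re|/eqP->]; last by rewrite expn0 dvd1n.
move: e2; rewrite -(ltn_predK lt_re) [in X in X = _]expnS -mulnA => /eqP.
rewrite eqn_pmul2l // => /eqP <-; rewrite dvdn_mulr // dvdn_exp2l //.
by rewrite -ltnS (ltn_predK lt_re).
Qed.

Lemma bin2_pow_mul_dvd n m : r <= n -> n <= m -> [|| odd p, r < m | r == 0] ->
  p ^ r %| p ^ (m - n) * 'C(p ^ n, 2).
Proof.
move=> le_rn le_nm reg; have [odd_p|even_p] := boolP (odd p).
  by rewrite dvdn_mull // bin2_pow_dvd ?odd_p.
have [r0|r_gt0] := posnP r; first by rewrite r0 expn0 dvd1n.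
have lt_rm : r < m by case/or3P: reg => // [/idPn//|/eqP r0]; rewrite r0 in r_gt0.
have [p2|] := even_prime p_pr; last by move/negP: even_p.
have : 2 * (p ^ (m - n) * 'C(p ^ n, 2)) = p ^ m * (p ^ n).-1.
  by rewrite mulnCA -mul_bin_diag bin1 mulnA -expnD subnK.
rewrite -(ltn_predK lt_rm) p2 [in X in _ = X]expnS -mulnA => /eqP.
rewrite eqn_pmul2l // => /eqP ->; rewrite dvdn_mulr // dvdn_exp2l //.
by rewrite -ltnS (ltn_predK lt_rm).
Qed.

End ModularArithmetic.

Lemma coprime_addl p u k : coprime p u -> coprime p (u + k * p).
Proof. by rewrite /coprime addnC gcdnMDl. Qed.

Lemma pow_split p k l : k < l -> (p ^ l = p ^ (l - k).-1 * p * p ^ k)%N.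
Proof. by move=> lt_kl; rewrite -expnSr -expnD; congr (_ ^ _)%N; lia. Qed.

(** * Normal form of the power relations *)

(** The valuations of i and j that no change of generators can raise further.
    The value t = r stands for b^(p^n) = 1 and s = r for a^(p^m) = 1; if t < s <
    t + (m - n), neither relation can be used to simplify the other. *)
Definition normal_exps (m n r s t : nat) : bool :=
  [&& s <= r, t <= r &
      [|| t == r, t < s < t + (m - n) | [&& n < m, s == r & t + (m - n) <= r]]].

Section Normalize.

Local Open Scope nat_scope.

Variables (p m n r : nat) (gT : finGroupType).
Hypotheses (p_pr : prime p) (le_nm : n <= m) (le_rn : r <= n).

Let p_gt0 : 0 < p. Proof. exact: prime_gt0. Qed.

Local Notation has_pair i j := (has_pair p m n r i j gT).

Lemma has_pair_congr i j i' j' : i = i' %[mod p ^ r] -> j = j' %[mod p ^ r] ->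
  has_pair i j -> has_pair i' j'.
Proof. by move=> ei ej [a [b D]]; exists a, b; apply: c2_congr ei ej. Qed.

Lemma has_pair_scale u s v t : coprime p u -> coprime p v ->
  has_pair (u * p ^ s) (v * p ^ t) -> has_pair (p ^ s) (p ^ t).
Proof.
move=> cu cv [a [b D]]; exists (a ^+ v)%g, (b ^+ u)%g.
apply: (c2_scale D) => //; congr (_ %% _).
  by rewrite mulnAC mulnC [u * v]mulnC.
by rewrite mulnAC mulnC.
Qed.

(** Replacing b by b a^(k p^(m - n)) adds k i to j, and replacing a by a b^k
    adds k j p^(m - n) to i. The first move makes b^(p^n) trivial if s <= t, the
    second makes a^(p^m) trivial if t + (m - n) <= s. Otherwise it only remains
    to scale a and b. The hypothesis on p, m and r makes the commutator
    corrections in both moves disappear. *)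
Lemma has_pair_normal i j : [|| odd p, r < m | r == 0] -> has_pair i j ->
  exists s t, normal_exps m n r s t /\ has_pair (p ^ s) (p ^ t).
Proof.
move=> reg P0.
have step_a i' j' k : has_pair i' j' -> has_pair (i' + k * (j' * p ^ (m - n))) j'.
  case=> a [b D]; exists (a * b ^+ k)%g, b.
  apply: (c2_congr (c2_change_a p_gt0 D k le_nm)) => //.
  have /dvdnP[q ->] := bin2_pow_dvd p_pr (leq_trans le_rn le_nm) reg.
  by rewrite mulnDr addnA addnC 2!mulnA modnMDl.
have step_b i' j' k : has_pair i' j' -> has_pair i' (j' + k * i').
  case=> a [b D]; exists a, (b * a ^+ (k * p ^ (m - n)))%g.
  apply: (c2_congr (c2_change_b p_gt0 D k le_nm)) => //.
  have /dvdnP[q ->] : p ^ r %| p ^ (m - n) * 'C(p ^ n, 2).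
    exact: bin2_pow_mul_dvd.
  by rewrite mulnDr addnA !mulnA addnC modnMDl.
have main s u t v : s <= r -> s <= t -> coprime p u -> has_pair (u * p ^ s) (v * p ^ t) ->
    exists s t, normal_exps m n r s t /\ has_pair (p ^ s) (p ^ t).
  move=> le_sr le_st cu P1; exists s, r; split.
    by rewrite /normal_exps le_sr eqxx leqnn.
  have [k dvd_k] := solve_mod r p_pr (v * p ^ (t - s)) cu.
  apply: (@has_pair_scale u s 1 r) => //; first exact: coprimen1.
  apply: has_pair_congr (step_b _ _ k P1) => //.
  rewrite mul1n modnn; apply/eqP.
  have -> : v * p ^ t + k * (u * p ^ s) = (v * p ^ (t - s) + k * u) * p ^ s.
    by rewrite mulnDl -!mulnA -expnD subnK.
  by rewrite -/(dvdn _ _) dvdn_mulr.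
have [s [u [le_sr cu ei]]] := unit_pow_split r p_pr i.
have [t [v [le_tr cv ej]]] := unit_pow_split r p_pr j.
have {i j P0 ei ej} P1 := has_pair_congr ei ej P0.
have [le_st|lt_ts] := leqP s t; first exact: main P1.
(* For m = n, replacing a by a b gives i the valuation t of j. *)
have [le_mn|lt_nm] := leqP m n.
  have := step_a _ _ 1 P1; rewrite (_ : m - n = 0); last by apply/eqP.
  rewrite expn0 mul1n muln1 (pow_split p lt_ts) mulnA -mulnDl addnC mulnA.
  by apply: main => //; apply: coprime_addl.
have [le_ds|lt_sd] := leqP (t + (m - n)) s; last first.
  exists s, t; split; first by rewrite /normal_exps le_sr le_tr lt_ts lt_sd orbT.
  exact: has_pair_scale P1.
exists r, t; split.
  by rewrite /normal_exps leqnn le_tr lt_nm eqxx (leq_trans le_ds le_sr) !orbT.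
have [k dvd_k] := solve_mod r p_pr (u * p ^ (s - (t + (m - n)))) cv.
apply: (@has_pair_scale 1 r v t) => //; first exact: coprimen1.
apply: has_pair_congr (step_a _ _ k P1) => //.
rewrite mul1n modnn; apply/eqP.
have -> : u * p ^ s + k * (v * p ^ t * p ^ (m - n))
    = (u * p ^ (s - (t + (m - n))) + k * v) * p ^ (t + (m - n)).
  by rewrite mulnDl -!mulnA -!expnD subnK.
by rewrite -/(dvdn _ _) dvdn_mulr.
Qed.

End Normalize.

Section NormalizeExceptional.

Local Open Scope nat_scope.

Variables (r : nat) (gT : finGroupType).
Hypothesis r_gt0 : 0 < r.

Let h := 2 ^ r.-1.
Local Notation has_pair i j := (has_pair 2 r r r i j gT).

Lemma double_h : 2 * h = 2 ^ r.
Proof. by rewrite -expnS prednK. Qed.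

Lemma bin2_pow2 : 'C(2 ^ r, 2) = h.-1 * 2 ^ r + h.
Proof.
apply/eqP; rewrite -(eqn_pmul2l (isT : 0 < 2)) -mul_bin_diag bin1 -double_h.
by have : 0 < h by [rewrite expn_gt0]; nia.
Qed.

(** For p = 2 and m = n = r, the map from G / G' to G' given by g^(2^r) is
    quadratic rather than additive, and its polar form has the values 1 and c^h:
    hence the shift by h in both moves. *)
Lemma exceptional_change_a i j k : has_pair i j -> has_pair (i + k * (j + h)) j.
Proof.
case=> a [b D]; exists (a * b ^+ k)%g, b.
apply: (c2_congr (c2_change_a (ltn0Sn 1) D k (leqnn r))) => //.
rewrite subnn expn0 muln1 bin2_pow2.
have -> : (2 ^ r).-1 * (h.-1 * 2 ^ r + h) = ((2 ^ r).-1 * h.-1 + h.-1) * 2 ^ r + h.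
  rewrite -double_h; case: h (expn_gt0 2 r.-1 : 0 < h) => // h' _.
  have -> : (2 * h'.+1).-1 = 2 * h' + 1 by lia.
  by rewrite succnK; nia.
rewrite [j + _]addnCA mulnDr [i + _]addnCA mulnA modnMDl; congr (_ %% _); lia.
Qed.

Lemma exceptional_change_b i j k : has_pair i j -> has_pair i (j + k * (i + h)).
Proof.
case=> a [b D]; exists a, (b * a ^+ (k * 2 ^ (r - r)))%g.
apply: (c2_congr (c2_change_b (ltn0Sn 1) D k (leqnn r))) => //.
rewrite subnn expn0 mul1n bin2_pow2.
by rewrite [i + (_ + _)]addnCA mulnDr [j + _]addnCA mulnA modnMDl.
Qed.

(** For r = 1 the last two cases are the groups D_8 and Q_8. *)
Lemma exceptional_normal i j : has_pair i j ->
  [\/ exists2 s, s.+1 < r & has_pair (2 ^ s) (2 ^ r),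
      has_pair (2 ^ r) (2 ^ r) | has_pair h h].
Proof.
move=> P0.
have main s u t v : s.+1 < r -> s <= t -> coprime 2 u -> has_pair (u * 2 ^ s) (v * 2 ^ t) ->
    exists2 s, s.+1 < r & has_pair (2 ^ s) (2 ^ r).
  move=> lt_sr le_st cu P1; exists s => //.
  have eh : h = 2 ^ (r.-1 - s).-1 * 2 * 2 ^ s by rewrite /h (@pow_split 2 s r.-1) //; lia.
  have [k dvd_k] := solve_mod r (isT : prime 2) (v * 2 ^ (t - s))
    (coprime_addl (2 ^ (r.-1 - s).-1) cu).
  apply: (@has_pair_scale 2 r r r gT isT u s 1 r) => //.
  apply: has_pair_congr (exceptional_change_b k P1) => //.
  rewrite mul1n modnn; apply/eqP.
  have -> : v * 2 ^ t + k * (u * 2 ^ s + h) =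
      (v * 2 ^ (t - s) + k * (u + 2 ^ (r.-1 - s).-1 * 2)) * 2 ^ s.
    by rewrite [RHS]mulnDl -mulnA -expnD subnK // -mulnA mulnDl -eh.
  by rewrite -/(dvdn _ _) dvdn_mulr.
have [s [u [le_sr cu ei]]] := unit_pow_split r (isT : prime 2) i.
have [t [v [le_tr cv ej]]] := unit_pow_split r (isT : prime 2) j.
have {i j P0 ei ej} P1 := has_pair_congr ei ej P0.
have [small|] := boolP ((s.+1 < r) || (t.+1 < r)).
  apply: Or31; have [le_st|lt_ts] := leqP s t.
    by apply: main P1 => //; lia.
  have lt_tr : t < r.-1 by case/orP: small; lia.
  have := exceptional_change_a 1 P1.
  rewrite mul1n /h (pow_split 2 lt_tr) (pow_split 2 lt_ts).
  rewrite [u * _]mulnA -!mulnDl addnCA [u * _]mulnA -mulnDl.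
  by apply: main => //; [lia | apply: coprime_addl].
rewrite negb_or -!leqNgt => /andP[le_rs le_rt].
have half w e : r <= e.+1 -> coprime 2 w -> e <= r ->
    w * 2 ^ e = 2 ^ r %[mod 2 ^ r] \/ w * 2 ^ e = h %[mod 2 ^ r].
  move=> le_re cw le_er; have [->|ne] := eqVneq e r; first by left; rewrite modnMl modnn.
  have -> : e = r.-1 by lia.
  right; have -> : w = w./2 * 2 + 1 by move: cw; rewrite coprime2n => odd_w; lia.
  by rewrite -/h mulnDl -mulnA double_h modnMDl mul1n.
have [ei|ei] := half u s le_rs cu le_sr; have [ej|ej] := half v t le_rt cv le_tr;
  have P2 := has_pair_congr ei ej P1.
- exact: Or32.
- apply: Or32; apply: has_pair_congr (exceptional_change_b 1 P2) => //.
  by rewrite mul1n addnCA addnn -muln2 mulnC double_h modnDr.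
- apply: Or32; apply: has_pair_congr (exceptional_change_a 1 P2) => //.
  by rewrite mul1n addnCA addnn -muln2 mulnC double_h modnDr.
exact: Or33.
Qed.

End NormalizeExceptional.

(** * Generators adapted to the abelianization *)

Section Existence.

Variables (p : nat) (gT : finGroupType).
Hypothesis p_pr : prime p.
Let G := [set: gT]%G.
Hypothesis pG : p.-group G.

Lemma abelian_rank2 (rT : finGroupType) (Q : {group rT}) : abelian Q -> 'r(Q) <= 2 ->
  exists x y, <[x]> \x <[y]> = Q /\ #[y] %| #[x].
Proof.
move=> abQ; rewrite -size_abelian_type //; have := abelian_type_dvdn_sorted Q.
have [s defQ <-] := abelian_structure abQ.
case: s defQ => [|x [|y [|//]]] /= defQ.
- by exists 1, 1; rewrite order1 -defQ big_nil cycle1 dprod1g.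
- by exists x, 1; rewrite order1 dvd1n -defQ big_seq1 cycle1 dprodg1.
by rewrite andbT => dvd_yx _; exists x, y; rewrite -defQ big_cons big_seq1.
Qed.

(** A basis of the abelianization lifts to generators of G, because the derived
    subgroup lies in the Frattini subgroup. The commutator of these generators
    spans the derived subgroup, as two commuting elements generate the quotient
    by it. The last two conclusions say that the abelianization determines m and
    n. *)
Lemma class2_pair_exists : G^`(1) \subset 'Z(G) -> 'r(G / G^`(1)) <= 2 ->
  exists m n r i j (a b : gT),
    [/\ n <= m, r <= n, class2_pair p m n r i j a b, #|G / G^`(1)| = (p ^ (m + n))%N
      & forall k, (forall q, q \in G / G^`(1) -> q ^+ (p ^ k) = 1) <-> m <= k].
Proof.
move=> sG'Z rQ; set Q := (G / G^`(1))%G.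
have abQ : abelian Q by apply: der_abelian 0 G.
have [x [y [defQ dvd_yx]]] := abelian_rank2 abQ rQ.
have pQ : p.-group Q by apply: quotient_pgroup.
have [_ defxy _ tixy] := dprodP defQ.
have Qx : x \in Q by rewrite -cycle_subG (subset_trans (mulG_subl <[y]> _)) ?defxy.
have Qy : y \in Q by rewrite -cycle_subG (subset_trans (mulG_subr <[x]> _)) ?defxy.
have [m ox] := p_natP (mem_p_elt pQ Qx).
have [n oy] := p_natP (mem_p_elt pQ Qy).
have cardQ : #|Q| = (p ^ (m + n))%N by rewrite -(dprod_card defQ) expnD -!orderE ox oy.
have [a nGa _ ex] := morphimP Qx; have [b nGb _ ey] := morphimP Qy.
pose M := <<[set a; b]>>%G.
have genM : M = G.
  apply/val_inj/Phi_nongen/eqP; rewrite eqEsubset subsetT /=.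
  have sG'Phi : G^`(1) \subset 'Phi(G) by rewrite (Phi_joing pG) joing_subl.
  apply: subset_trans (genS (setSU _ sG'Phi)).
  change (is_true (G \subset G^`(1) <*> [set a; b])).
  rewrite -joing_idr norm_joinEr ?(subset_trans (subsetT _) (der_norm 1 G)) //.
  rewrite -quotientSK ?der_norm // -/(gval Q) -defxy mul_subG ?cycle_subG //.
    by rewrite ex mem_quotient ?mem_gen ?set21.
  by rewrite ey mem_quotient ?mem_gen ?set22.
pose c := [~ a, b].
have cen g h : g \in G^`(1) -> commute h g.
  by move=> /(subsetP sG'Z)/centerP[_ cgG]; apply/commute_sym/cgG; rewrite inE.
have cG' : c \in G^`(1) by rewrite mem_commg ?inE.
have nc : <[c]> <| G.
  rewrite /normal subsetT cents_norm // centsC cycle_subG.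
  by apply/centP=> g _; apply/commute_sym/cen.
have G'c : G^`(1) = <[c]>.
  apply/eqP; rewrite eqEsubset cycle_subG cG' andbT der1_min ?normal_norm //.
  have [ca cb] : a \in 'N(<[c]>) /\ b \in 'N(<[c]>).
    by split; apply: (subsetP (normal_norm nc)); rewrite inE.
  rewrite -genM quotient_gen ?subUset ?sub1set ?ca // abelian_gen.
  rewrite quotientU !quotient_set1 // /abelian subUset !sub1set.
  have cab : commute (coset <[c]> a) (coset <[c]> b).
    apply/commgP; rewrite -morphR //= coset_id ?cycle_id //.
  by apply/andP; split; apply/centP=> z /set2P[] ->.
have [r oc] := p_natP (mem_p_elt pG (in_setT c)).
have inG' g : coset G^`(1) g = 1 -> exists i, g = c ^+ i.
  move=> /coset_idr => h; have : g \in G^`(1).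
    by apply: h; rewrite (subsetP (der_norm 1 G)) ?inE.
  by rewrite G'c => /cycleP[i ->]; exists i.
have [i ai] : exists i, a ^+ (p ^ m) = c ^+ i.
  by apply: inG'; rewrite morphX // -ex -ox expg_order.
have [j bj] : exists j, b ^+ (p ^ n) = c ^+ j.
  by apply: inG'; rewrite morphX // -ey -oy expg_order.
exists m, n, r, i, j, a, b; split=> //.
- by move: dvd_yx; rewrite ox oy dvdn_Pexp2l ?prime_gt1.
- rewrite -(dvdn_Pexp2l _ _ (prime_gt1 p_pr)) -oc order_dvdn; apply/eqP.
  rewrite -commgX ?bj; last exact: cen.
  by apply/eqP/commgP/commuteX/cen.
- split=> //; first by move/(congr1 val): genM.
    by move=> g; apply: cen.
  rewrite -expnD -cardQ -oc orderE -G'c card_quotient ?der_norm //.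
  by rewrite mulnC Lagrange ?der_sub.
move=> k; split=> [h|le_mk q].
  by rewrite -(dvdn_Pexp2l _ _ (prime_gt1 p_pr)) -ox order_dvdn h.
change (G / G^`(1)) with (gval Q); rewrite -defxy => /mulsgP[s t sx ty ->].
have eK (u v : coset_of G^`(1)) : #[u] %| p ^ k -> v \in <[u]> -> v ^+ (p ^ k) = 1.
  move=> dvd_k /cycleP[l ->]; rewrite -expgM mulnC expgM.
  by rewrite (eqP (_ : u ^+ _ == 1)) ?expg1n // -order_dvdn.
have dx : #[x] %| p ^ k by rewrite ox dvdn_exp2l.
rewrite expgMn; first by rewrite (eK x s) ?(eK y t) ?mulg1 // (dvdn_trans dvd_yx).
by apply: (centsP abQ); [move: s sx | move: t ty]; apply/subsetP; rewrite cycle_subG.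
Qed.

End Existence.

(** * The exponents s and t and the power map *)

Section PowerStructure.

Variables (p m n r s t : nat) (gT : finGroupType) (a b : gT).
Hypotheses (p_pr : prime p) (le_nm : n <= m) (le_rn : r <= n).
Hypothesis D : class2_pair p m n r (p ^ s) (p ^ t) a b.
Let c := [~ a, b].
Let p_gt0 : 0 < p. Proof. exact: prime_gt0. Qed.

Lemma c2_expM_comm (g h : gT) e :
  exists l, (g * h) ^+ e = g ^+ e * h ^+ e * c ^+ (l * 'C(e, 2)).
Proof.
have [l hl] := c2_comm_mem p_gt0 D h g; exists l.
by rewrite expMg_Rmul hl ?expgM //; apply: c2_centX D _ _.
Qed.

(** The p^k-power map is multiplicative under the hypothesis on k, so only a and
    b have to be tested. *)
Lemma c2_exponent k : m <= k -> p ^ r %| 'C(p ^ k, 2) ->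
  (forall g : gT, g ^+ (p ^ k) = 1) <-> (m + r <= k + s) && (n + r <= k + t).
Proof.
move=> le_mk dvd_k; have le_nk := leq_trans le_nm le_mk.
have ea : a ^+ (p ^ k) = c ^+ (p ^ (s + (k - m))).
  by rewrite -{1}(subnKC le_mk) expnD expgM (c2_powa D) -expgM -expnD.
have eb : b ^+ (p ^ k) = c ^+ (p ^ (t + (k - n))).
  by rewrite -{1}(subnKC le_nk) expnD expgM (c2_powb D) -expgM -expnD.
have triv l : (c ^+ (p ^ l) == 1) = (r <= l).
  by rewrite -order_dvdn (c2_order D) dvdn_Pexp2l ?prime_gt1.
split=> [h | /andP[les let_] g].
  have := h a; have := h b; rewrite ea eb => /eqP; rewrite triv => le1 /eqP.
  by rewrite triv => le2; apply/andP; split; lia.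
have [x [y [z ->]]] := c2_normal_form p_gt0 D g.
rewrite (c2_expM p_gt0 D _ (c ^+ z) dvd_k) (c2_expM p_gt0 D _ (b ^+ y) dvd_k).
rewrite -!expgM ![(_ * p ^ k)%N]mulnC !expgM ea eb.
have c1 l : r <= l -> c ^+ (p ^ l) = 1 by move=> le_rl; apply/eqP; rewrite triv.
rewrite !c1; [ | lia | lia | lia].
by rewrite !expg1n !mulg1.
Qed.

(** The p^n-th powers of b and of a^(p^(m - n)) are c^(p^t) and c^(p^s). Modulo
    <c^(p^l)>, every p^n-th power that lies in the derived subgroup is a product
    of powers of these two. *)
Lemma c2_power_sep l : l <= r -> p ^ l %| 'C(p ^ n, 2) ->
    (forall (g h : gT) e, g ^+ (p ^ n) = h ^+ (p ^ n) * c ^+ e ->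
        exists e', g ^+ (p ^ n) = h ^+ (p ^ n) * c ^+ (p ^ l * e'))
  <-> (l <= s) && (l <= t).
Proof.
move=> le_lr dvd_C; split=> [sep | /andP[le_ls le_lt] g h e].
  have dvd (u : nat) (g : gT) : g ^+ (p ^ n) = c ^+ (p ^ u) -> l <= u.
    move=> eg; have [|e'] := sep g 1 (p ^ u)%N; first by rewrite expg1n mul1g.
    rewrite expg1n mul1g eg => /eqP; rewrite (c2_eq_exp D) => /eqP e_mod.
    rewrite -(dvdn_Pexp2l _ _ (prime_gt1 p_pr)) /dvdn -(modn_dvdm _ (dvdn_exp2l p le_lr)).
    by rewrite e_mod modn_dvdm ?dvdn_exp2l // modnMr.
  rewrite (dvd t b) ?(c2_powb D) // (dvd s (a ^+ (p ^ (m - n)))) //.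
  by rewrite -expgM -expnD subnK // (c2_powa D).
have -> : g = h * (h^-1 * g) by rewrite mulKVg.
have [x [y [z ->]]] := c2_normal_form p_gt0 D (h^-1 * g).
have [l1 ->] := c2_expM_comm h (a ^+ x * b ^+ y * c ^+ z) (p ^ n).
have [l2 ->] := c2_expM_comm (a ^+ x * b ^+ y) (c ^+ z) (p ^ n).
have [l3 ->] := c2_expM_comm (a ^+ x) (b ^+ y) (p ^ n).
rewrite -!mulgA => /mulgI; rewrite -!expgM -!expgD.
set e1 := (_ + _)%N => ab_e.
have : a ^+ (x * p ^ n) * b ^+ (y * p ^ n) = c ^+ (e + (p ^ r).-1 * e1).
  by rewrite expgD -(c2_invX p_gt0 D) -ab_e -!mulgA mulgV mulg1.
case/(c2_dvd p_gt0 D) => /dvdnP[x' ->] _; rewrite mulnC [(y * _)%N]mulnC !expgM.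
rewrite (c2_powa D) (c2_powb D) -!expgM -!expgD.
suff /dvdnP[q ->] : p ^ l %| p ^ s * x' + (p ^ t * y + e1) by exists q; rewrite mulnC.
have dvd_n : p ^ l %| p ^ n by rewrite dvdn_exp2l // (leq_trans le_lr).
have dvd_s : p ^ l %| p ^ s by rewrite dvdn_exp2l.
have dvd_t : p ^ l %| p ^ t by rewrite dvdn_exp2l.
by do ?apply: dvdn_add; solve [exact: dvdn_mull | exact: dvdn_mulr].
Qed.

End PowerStructure.

(** Here p^e is the exponent of the group and q = min (s, t). *)
Lemma normal_exps_cases m n r s t : n <= m -> normal_exps m n r s t ->
  [/\ s <= r, t <= r & exists e q,
  [/\ forall k, (m + r <= k + s) && (n + r <= k + t) = (e <= k),
     forall l, (l <= s) && (l <= t) = (l <= q), m <= e &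
     [\/ [/\ t = r, e + s = m + r & q = s],
        [/\ t < s < t + (m - n), e + s = m + r & q = t] |
        [/\ n < m, s = r, t < r, e + t = n + r & q = t]]]].
Proof.
move=> le_nm /and3P[le_sr le_tr N]; split=> //.
have [et|lt_tr] := eqVneq t r.
  exists (m + r - s), s; split; [move=> k | move=> l | |]; try lia.
  by apply: Or31; split; lia.
case/or3P: N => [/eqP et|lt_ts|/and3P[lt_nm /eqP es le_r]]; first by rewrite et eqxx in lt_tr.
  exists (m + r - s), t; split; [move=> k | move=> l | |]; try lia.
  by apply: Or32; split => //; lia.
exists (n + r - t), t; split; [move=> k | move=> l | |]; try lia.
by apply: Or33; split=> //; lia.
Qed.

(** If min (s, t) is only known up to r - 1, a single ambiguity is left. *)
Lemma normal_exps_inj m n r s t s' t' l0 :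
    n <= m -> r.-1 <= l0 <= r ->
    normal_exps m n r s t -> normal_exps m n r s' t' ->
    (forall k, m <= k ->
       (m + r <= k + s) && (n + r <= k + t) = (m + r <= k + s') && (n + r <= k + t')) ->
    (forall l, l <= l0 -> (l <= s) && (l <= t) = (l <= s') && (l <= t')) ->
  s = s' /\ t = t' \/
    [/\ l0 < r, n < m, s = r, s' = r & t = r /\ t' = r.-1 \/ t = r.-1 /\ t' = r].
Proof.
move=> le_nm /andP[le1 le2].
case/(normal_exps_cases le_nm)=> [le_sr le_tr [e [q [expE minE le_me N]]]].
case/(normal_exps_cases le_nm)=> [le_sr' le_tr' [e' [q' [expE' minE' le_me' N']]]].
move=> exp_eq sep_eq.
have ee : e = e'.
  apply/eqP; rewrite eqn_leq -expE' -exp_eq // expE leqnn /=.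
  by rewrite -expE exp_eq // expE' leqnn.
have leq_q l : l <= l0 -> (l <= q) = (l <= q') by move=> /sep_eq; rewrite minE minE'.
have q_cases : q = q' \/ l0 <= q /\ l0 <= q'.
  have [le_q|lt_q] := leqP l0 q.
    by right; rewrite -leq_q.
  left; have := leq_q q (ltnW lt_q); have := leq_q q.+1 lt_q; rewrite leqnn ltnn; lia.
clear expE minE expE' minE' exp_eq sep_eq leq_q.
have [el|lt_l] : l0 = r \/ l0 < r by lia.
  by left; case: N => [[*]|[/andP[? ?] *]|[*]]; case: N' => [[*]|[/andP[? ?] *]|[*]]; lia.
have el : l0 = r.-1 by lia.
have [eq_st|ne] : (s = s' /\ t = t') \/ (s <> s' \/ t <> t') by lia.
  by left.
right; split=> //.
all: case: N => [[*]|[/andP[? ?] *]|[*]]; case: N' => [[*]|[/andP[? ?] *]|[*]]; lia.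
Qed.

(** * Coordinates modulo 2 *)

Section Parity.

Variables (r m i j : nat) (gT : finGroupType) (a b : gT).
Hypotheses (r_gt0 : 0 < r) (le_rm : r <= m).
Hypothesis D : class2_pair 2 m r r i j a b.
Let c := [~ a, b].
Let two_gt0 : 0 < 2. Proof. by []. Qed.

(** The exponents of a and b in a normal form are unique modulo 2^m and 2^r, so
    their parities are functions of the element. *)
Lemma c2_parity : exists X Y : gT -> bool,
  forall x y z, X (a ^+ x * b ^+ y * c ^+ z) = odd x
             /\ Y (a ^+ x * b ^+ y * c ^+ z) = odd y.
Proof.
pose T := ('I_(2 ^ m) * 'I_(2 ^ r) * 'I_(2 ^ r))%type.
pose nf (t : T) := a ^+ t.1.1 * b ^+ t.1.2 * c ^+ t.2.
have P_gt0 k : 0 < 2 ^ k by rewrite expn_gt0.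
exists (fun g => [exists t : T, odd t.1.1 && (g == nf t)]),
       (fun g => [exists t : T, odd t.1.2 && (g == nf t)]) => x y z.
have odd_mod u v k : 0 < k -> u = v %[mod 2 ^ k] -> odd u = odd v.
  move=> k_gt0 e; rewrite -(@odd_mod u (2 ^ k)) ?oddX ?e ?odd_mod ?oddX -?lt0n //;
  by rewrite ?(gtn_eqF k_gt0).
have [z' ez] := c2_reduce two_gt0 D x y z.
pose t := (Ordinal (ltn_pmod x (P_gt0 m)), Ordinal (ltn_pmod y (P_gt0 r)), z').
split.
  apply/existsP/idP=> [[u /andP[odd_u /eqP /(c2_normal_form_mod two_gt0 D)[e _]]]|odd_x].
    by rewrite (odd_mod _ _ m _ e) // (leq_trans r_gt0).
  exists t; rewrite /nf /= -ez eqxx andbT (odd_mod _ x m) ?modn_mod // (leq_trans r_gt0) //.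
apply/existsP/idP=> [[u /andP[odd_u /eqP /(c2_normal_form_mod two_gt0 D)[_ e]]]|odd_y].
  by rewrite (odd_mod _ _ r _ e).
by exists t; rewrite /nf /= -ez eqxx andbT (odd_mod _ y r) ?modn_mod.
Qed.

(** The last factor is the involution of the derived subgroup if x and y are
    both odd, and 1 otherwise. *)
Lemma c2_pow2 x y z : (a ^+ x * b ^+ y * c ^+ z) ^+ (2 ^ r)
  = a ^+ (2 ^ r * x) * b ^+ (2 ^ r * y) * c ^+ (2 ^ r.-1 * (x * y)).
Proof.
have c1 : c ^+ (2 ^ r) = 1 by apply: c2_exp D.
have cz u v : commute u (c ^+ v) by apply: c2_centX D _ _.
rewrite (expgMn _ (cz _ _)) -[c ^+ z ^+ _]expgM mulnC expgM c1 expg1n mulg1.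
rewrite expMg_Rmul (c2_commXXV two_gt0 D) //.
rewrite -!expgM ![(_ * 2 ^ r)%N]mulnC; congr (_ * _).
rewrite bin2_pow2 //; apply/eqP; rewrite (c2_eq_exp D).
have -> : ((2 ^ r).-1 * (x * y) * ((2 ^ r.-1).-1 * 2 ^ r + 2 ^ r.-1)
  = (2 ^ r).-1 * (x * y) * (2 ^ r.-1).-1 * 2 ^ r + x * y * ((2 ^ r).-1 * 2 ^ r.-1))%N by nia.
rewrite modnMDl -(double_h r_gt0).
have -> : ((2 * 2 ^ r.-1).-1 * 2 ^ r.-1 = (2 ^ r.-1).-1 * (2 * 2 ^ r.-1) + 2 ^ r.-1)%N.
  by case: (2 ^ r.-1)%N (expn_gt0 2 r.-1) => // k _; rewrite mulnS /=; nia.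
by rewrite mulnDr mulnA modnMDl mulnC.
Qed.

End Parity.
Local Open Scope ring_scope.

(** * Trace forms and powers in a group algebra *)

(** The other orbits have length divisible by p, so they contribute 0. *)
Lemma sum_Fp_fixed_points p (aT : finGroupType) (G : {group aT}) (W : finType)
    (to : {action aT &-> W}) (F : W -> 'F_p) :
    prime p -> p.-group G -> (forall a w, a \in G -> F (to w a) = F w) ->
  \sum_w F w = \sum_(w in 'Fix_to(G)%g) F w.
Proof.
move=> p_pr pG Fto.
have by_value (P : pred W) :
    \sum_(w | P w) F w = \sum_(v : 'F_p) v *+ #|[set w | P w & F w == v]|.
  rewrite (partition_big F xpredT) //=; apply: eq_bigr => v _.
  rewrite (eq_bigr (fun=> v)) => [|w /andP[_ /eqP]] //.
  by rewrite sumr_const; congr (_ *+ _); apply: eq_card => w; rewrite !inE.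
rewrite [LHS]by_value by_value; apply: eq_bigr => v _.
set S := [set w | _ & _]; set T := [set w | _ & _].
have actS : [acts G, on S | to].
  apply/actsP=> a aG w; rewrite !inE /= Fto //.
have := pgroup_fix_mod pG actS.
have -> : 'Fix_(S | to)(G)%g = T by apply/setP=> w; rewrite !inE /= andbC.
by move=> e; rewrite -!(mulr_natr v) -(Fp_nat_mod p_pr #|S|) e Fp_nat_mod.
Qed.

Section GroupElements.

Variables (F : comNzRingType) (gT : finGroupType).
Local Notation A := (galg F gT).

Definition gelt (g : gT) : A := [ffun h => (h == g)%:R].

Lemma gelt_mulE g (x : A) h : (gelt g * x) h = x (g^-1 * h)%g.
Proof.
rewrite ffunE (bigD1 g) //= ffunE eqxx mul1r big1 ?addr0 // => k /negbTE ne.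
by rewrite ffunE ne mul0r.
Qed.

Lemma gelt1 : gelt 1 = 1.
Proof. by apply/ffunP=> h; rewrite !ffunE. Qed.

Lemma geltM g h : gelt (g * h)%g = gelt g * gelt h.
Proof. by apply/ffunP=> k; rewrite gelt_mulE !ffunE (canF_eq (mulKVg g)). Qed.

Lemma geltX g k : gelt (g ^+ k)%g = gelt g ^+ k.
Proof. by elim: k => [|k IHk]; rewrite ?gelt1 // expgS exprS geltM IHk. Qed.

Lemma galg_sum (x : A) : x = \sum_g x g *: gelt g.
Proof.
apply/ffunP=> h; rewrite sum_ffunE (bigD1 h) //= !ffunE eqxx mulr1.
by rewrite big1 ?addr0 // => g /negbTE ne; rewrite !ffunE eq_sym ne mulr0.
Qed.

End GroupElements.

Section TracePower.

Variables (p : nat) (gT : finGroupType).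
Hypothesis p_pr : prime p.
Local Notation A := (galg 'F_p gT).

Lemma Fp_pow_fixed (v : 'F_p) k : v ^+ (p ^ k) = v.
Proof.
have vp : v ^+ p = v by have := expf_card v; rewrite card_Fp.
by elim: k => [|k IHk]; rewrite ?expr1 // expnS exprM vp.
Qed.

Lemma iter_ordS n m (i : 'I_n.+1) :
  iter m (ordS (n:=n.+1)) i = ((i + m)%N %% n.+1)%N :> nat.
Proof.
elim: m => [|m IHm] /=; first by rewrite addn0 modn_small.
by rewrite IHm -[(_ %% _).+1%N]addn1 modnDml addn1 addnS.
Qed.

Section Word.

Variable n : nat.
Local Notation W := {ffun 'I_n.+1 -> gT}.

Definition shift_word (w : W) : W := [ffun i => w (ordS i)].

Lemma shift_word_inj : injective shift_word.
Proof.
move=> w w' /ffunP e; apply/ffunP=> i; have := e (ord_pred i).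
by rewrite !ffunE ord_predK.
Qed.

Lemma shift_word_order : ((perm shift_word_inj) ^+ n.+1 = 1)%g.
Proof.
apply/permP=> w; rewrite permX perm1; apply/ffunP=> i.
have iterE m : iter m (perm shift_word_inj) w i = w (iter m (ordS (n:=n.+1)) i).
  by elim: m i => [|m IHm] i //=; rewrite permE ffunE IHm -iterSr.
by rewrite iterE; congr (w _); apply: ord_inj; rewrite iter_ordS modnDr modn_small.
Qed.

Lemma shift_word_fixed (w : W) : shift_word w = w -> w = [ffun=> w ord0].
Proof.
move=> /ffunP e; have shift1 i : w (ordS i) = w i by rewrite -[RHS]e ffunE.
apply/ffunP=> i; rewrite ffunE.
have -> : i = iter i (ordS (n:=n.+1)) ord0.
  by apply: ord_inj; rewrite iter_ordS add0n modn_small.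
by elim: (val i) => //= m IHm; rewrite shift1.
Qed.

Variable phi : {scalar A}.
Hypothesis phiC : forall x y, phi (x * y) = phi (y * x).

(** A trace form does not notice a cyclic rotation of the factors. *)
Lemma trace_shift_word (u : gT -> A) (w : W) :
  phi (\prod_i u (shift_word w i)) = phi (\prod_i u (w i)).
Proof.
rewrite big_ord_recr big_ord_recl /= phiC; congr (phi (_ * _)).
  by rewrite ffunE; congr (u (w _)); apply/val_inj; rewrite /= modnn.
apply: eq_bigr => i _; rewrite ffunE; congr (u (w _)); apply/val_inj.
by rewrite /= modn_small // ltnS.
Qed.

End Word.

(** Expand x^(p^k) over the words of length p^k in the group elements. Rotation
    acts on these words through a p-group and preserves their traces, and its
    fixed points are the constant words. *)
Lemma trace_pow (phi : {scalar A}) k (x : A) :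
    (forall x y, phi (x * y) = phi (y * x)) ->
  phi (x ^+ (p ^ k)) = \sum_g x g * phi (gelt 'F_p (g ^+ (p ^ k))%g).
Proof.
move=> phiC; have [n en] : exists n, (p ^ k = n.+1)%N.
  by exists (p ^ k).-1; rewrite prednK // expn_gt0 prime_gt0.
pose u (g : gT) : A := x g *: gelt _ g.
have -> : x ^+ (p ^ k) = \sum_(w : {ffun 'I_n.+1 -> gT}) \prod_i u (w i).
  rewrite -(bigA_distr_bigA (fun=> u)) prodr_const card_ord -en; congr (_ ^+ _).
  exact: galg_sum.
pose s := perm (@shift_word_inj n).
have fixE (w : {ffun 'I_n.+1 -> gT}) : (w \in 'Fix_('P)(<[s]>)%g) = (shift_word w == w).
  by rewrite afix_cycle ?inE // sub1set inE /= /aperm permE.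
rewrite raddf_sum /= (sum_Fp_fixed_points (to := 'P) (G := <[s]>%G)) //=.
- rewrite (eq_bigl _ _ fixE) (reindex (fun g => [ffun=> g] : {ffun 'I_n.+1 -> gT})) /=; last first.
    exists (fun w : {ffun 'I_n.+1 -> gT} => w ord0) => [g _ | w]; first by rewrite ffunE.
    by move=> /eqP/shift_word_fixed.
  apply: eq_big => [g | g _].
    by apply/eqP/ffunP=> i; rewrite !ffunE.
  rewrite (eq_bigr (fun=> u g)) => [|i _]; last by rewrite ffunE.
  rewrite prodr_const card_ord -en /u exprZn linearZ /= Fp_pow_fixed //.
  by rewrite geltX.
- apply: (@pnat_dvd _ (p ^ k)); last by rewrite pnatX pnat_id.
  by rewrite -orderE order_dvdn en shift_word_order.
move=> _ w /cycleP[m ->]; elim: m => [|m IHm]; first by rewrite act1.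
by rewrite expgSr actM /= /aperm permE trace_shift_word.
Qed.

End TracePower.

Section TraceForms.

Variables (R : comNzRingType) (B : algType R).
Implicit Type phi : {scalar B}.

Definition is_trace phi := forall x y : B, phi (x * y) = phi (y * x).

(** For N = 1 these forms vanish on the ideal generated by commutators. When
    that ideal is generated by a central element of the form t (x y - y x), they
    vanish on its N-th power. *)
Definition kills_comm N phi :=
  forall t x y s : B, phi ((t * (x * y - y * x)) ^+ N * s) = 0.

Lemma kills_comm1_trace phi : kills_comm 1 phi -> is_trace phi.
Proof.
move=> kphi x y; apply/eqP; rewrite -subr_eq0 -linearB /=.
by have := kphi 1 x y 1; rewrite expr1 mul1r mulr1 => ->.
Qed.

End TraceForms.

Section Functionals.

Variables (p : nat) (gT : finGroupType).
Local Notation A := (galg 'F_p gT).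
Local Notation gelt := (gelt 'F_p).
Implicit Types (x y : A) (v : gT -> 'F_p).

Lemma galg_ind (P : A -> Prop) :
    (forall g, P (gelt g)) -> (forall a x y, P x -> P y -> P (a *: x + y)) ->
  forall x, P x.
Proof.
move=> Pg Plin x; have P0 : P 0.
  by have := Plin (-1) _ _ (Pg 1%g) (Pg 1%g); rewrite scaleN1r addNr.
rewrite [x]galg_sum; elim/big_ind: _ => // [y z Py Pz|g _].
  by rewrite -[y]scale1r; apply: Plin.
by rewrite -[_ *: _]addr0; apply: Plin.
Qed.

Definition extend v (x : A) : 'F_p := \sum_g x g * v g.

Fact extend_is_scalar v : scalar (extend v).
Proof.
move=> a x y; rewrite /extend big_distrr -big_split /=; apply: eq_bigr => g _.
by rewrite !ffunE mulrDl mulrA.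
Qed.

HB.instance Definition _ v :=
  GRing.isLinear.Build 'F_p A 'F_p *%R (extend v) (extend_is_scalar v).

Lemma extend_gelt v g : extend v (gelt g) = v g.
Proof.
rewrite /extend (bigD1 g) //= ffunE eqxx mul1r big1 ?addr0 // => h /negbTE ne.
by rewrite ffunE ne mul0r.
Qed.

Lemma extend_trace v : (forall g h, v (g * h)%g = v (h * g)%g) -> is_trace (extend v).
Proof.
move=> vC x y; elim/galg_ind: x => [g|a x x' IH IH'].
  elim/galg_ind: y => [h|a y y' IH IH']; first by rewrite -!geltM /= !extend_gelt vC.
  by rewrite mulrDl mulrDr !linearD /= -scalerAl -scalerAr !linearZ /= IH IH'.
by rewrite mulrDl mulrDr !linearD /= -scalerAl -scalerAr !linearZ /= IH IH'.
Qed.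

Lemma coef1_trace : is_trace (extend (fun g : gT => (g == 1%g)%:R)).
Proof.
apply: extend_trace => g h; have -> : (h * g = (g * h) ^ g)%g.
  by rewrite conjgE -mulgA mulKg.
by rewrite conjg_eq1.
Qed.

Definition aug : A -> 'F_p := extend (fun=> 1).

Lemma augE x : aug x = \sum_g x g.
Proof. by apply: eq_bigr => g _; rewrite mulr1. Qed.

Lemma aug_gelt g : aug (gelt g) = 1.
Proof. exact: extend_gelt. Qed.

HB.instance Definition _ :=
  GRing.isLinear.Build 'F_p A 'F_p *%R aug (extend_is_scalar (fun=> 1)).

Fact aug_monoid : monoid_morphism aug.
Proof.
split=> [|x y]; first by rewrite -gelt1 aug_gelt.
elim/galg_ind: x => [g|a x x' IH IH'].
  elim/galg_ind: y => [h|a y y' IH IH']; first by rewrite -geltM !aug_gelt mulr1.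
  by rewrite mulrDr !linearD /= -scalerAr !linearZ /= IH IH' mulrDr mulrCA.
by rewrite mulrDl !linearD /= -scalerAl !linearZ /= IH IH' mulrDl mulrA.
Qed.

HB.instance Definition _ := GRing.isMonoidMorphism.Build A 'F_p aug aug_monoid.

End Functionals.

Section Cosets.

Variables (p : nat) (gT : finGroupType).
Local Notation A := (galg 'F_p gT).
Local Notation gelt := (gelt 'F_p).
Local Notation G' := ([set: gT]^`(1))%g.

(** Such a form does not change when a commutator is multiplied on the right of
    a group element, and commutators generate the derived subgroup. *)
Lemma kills_comm1_coset (phi : {scalar A}) g h : kills_comm 1 phi ->
  (g^-1 * h)%g \in G' -> phi (gelt g) = phi (gelt h).
Proof.
move=> kphi; rewrite -{2}(mulKVg g h); move: (_ * h)%g => z.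
pose S := [set z | [forall u, phi (gelt (u * z)%g) == phi (gelt u)]].
have gS : group_set S.
  apply/group_setP; split=> [|y1 y2]; rewrite !inE.
    by apply/forallP=> u; rewrite mulg1.
  by move=> /forallP h1 /forallP h2; apply/forallP=> u; rewrite mulgA (eqP (h2 _)).
suff /subsetP sub : G' \subset Group gS.
  by move/sub; rewrite inE => /forallP/(_ g)/eqP ->.
rewrite gen_subG; apply/subsetP=> _ /imset2P[x y _ _ ->]; rewrite inE; apply/forallP=> u.
have := kphi (gelt (u * (y * x)^-1)%g) (gelt x) (gelt y) 1.
rewrite expr1 mulr1 mulrBr linearB /= -!geltM => /eqP; rewrite subr_eq0.
by rewrite mulgKV [(x * y)%g]commgC [(u * _ * (_ * _))%g]mulgA mulgKV.
Qed.

Lemma extend_kills_comm1 (v : gT -> 'F_p) :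
    (forall g h, (g^-1 * h)%g \in G' -> v g = v h) -> kills_comm 1 (extend v).
Proof.
move=> vG'.
suff swap t x y s : extend v (t * x * y * s) = extend v (t * y * x * s).
  by move=> t x y s; rewrite expr1 mulrBr mulrBl linearB /= !mulrA swap subrr.
elim/galg_ind: t => [t|a t t' IH IH']; last first.
  by rewrite !mulrDl -!scalerAl !linearP /= IH IH'.
elim/galg_ind: x => [x|a x x' IH IH']; last first.
  by rewrite !(mulrDr, mulrDl) -!(scalerAr, scalerAl) !linearP /= IH IH'.
elim/galg_ind: y => [y|a y y' IH IH']; last first.
  by rewrite !(mulrDr, mulrDl) -!(scalerAr, scalerAl) !linearP /= IH IH'.
elim/galg_ind: s => [s|a s s' IH IH']; last first.
  by rewrite !mulrDr -!scalerAr !linearP /= IH IH'.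
rewrite -!geltM !extend_gelt; apply: vG'.
have -> : ((t * x * y * s)^-1 * (t * y * x * s) = [~ y, x] ^ s)%g.
  by rewrite !invMg conjgE commgEl conjgE !mulgA mulgKV.
rewrite memJ_norm; first by rewrite mem_commg ?inE.
by apply: (subsetP (der_norm 1 [set: gT])); rewrite inE.
Qed.

End Cosets.

(** * Counting functions with vanishing fibre sums *)

Section FiberSums.

Variables (F : finNzRingType) (T Y : finType) (f : T -> Y).

Definition zero_fiber_sums : {set {ffun T -> F}} :=
  [set x : {ffun T -> F} | [forall y, \sum_(g | f g == y) x g == 0]].

Let rep (g : T) : T := odflt g [pick h | f h == f g].

Lemma f_rep g : f (rep g) = f g.
Proof. by rewrite /rep; case: pickP => [h /eqP|]. Qed.

Lemma rep_eq g h : f g = f h -> rep g = rep h.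
Proof.
move=> e; rewrite /rep e; case: pickP => // /(_ h); rewrite eqxx; by [].
Qed.

Let R : {set T} := [set g | rep g == g].

Lemma card_rep : #|R| = #|f @: [set: T]|.
Proof.
rewrite -(card_in_imset (f := f) (D := R)).
  congr #|pred_of_set _|; apply/setP=> y; apply/imsetP/imsetP=> [[g _ ->]|[g _ ->]].
    by exists g; rewrite ?inE.
  by exists (rep g); rewrite ?f_rep // inE (rep_eq (f_rep g)).
by move=> g h; rewrite !inE => /eqP eg /eqP eh /rep_eq; rewrite eg eh.
Qed.

(** Choose a representative in every fibre: the values off the representatives
    are arbitrary, and they determine the remaining ones. *)
Lemma card_zero_fiber_sums :
  (#|zero_fiber_sums| * #|F| ^ #|f @: [set: T]| = #|F| ^ #|T|)%N.
Proof.
pose off (x : {ffun T -> F}) : {ffun T -> F} := [ffun g => if g \in R then 0 else x g].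
pose fix_ (x : {ffun T -> F}) : {ffun T -> F} :=
  [ffun g => if g \in R then - \sum_(h | (f h == f g) && (h != g)) x h else x g].
have notR g h : g \in R -> f h == f g -> h != g -> h \notin R.
  rewrite !inE => /eqP eg /eqP efh ne; apply: contra ne => /eqP eh.
  by rewrite -eg -eh (rep_eq efh).
have -> : #|zero_fiber_sums| = #|pffun_on (0 : F) [pred g | g \notin R] predT|.
  rewrite -(card_in_imset (f := off) (D := zero_fiber_sums)).
    apply: eq_card => x; apply/imsetP/pffun_onP=> [[z _ ->]|[/subsetP supp _]].
      split; last by move=> ? _.
      by apply/subsetP=> g; rewrite !inE ffunE inE; case: (rep g == g) => //; rewrite eqxx.
    have x0 g : g \in R -> x g = 0.
      move=> gR; apply/eqP; have := supp g; rewrite !inE; case: eqP => // _ /(_ isT).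
      by move: gR; rewrite inE => ->.
    exists (fix_ x); last first.
      apply/ffunP=> g; rewrite !ffunE.
      by have [gR|gR] := boolP (g \in R); rewrite ?(x0 g gR) // (negbTE gR).
    rewrite inE; apply/forallP=> y.
    have [g /= /eqP gy|none] := pickP (fun g => f g == y); last by rewrite big_pred0.
    have rR : rep g \in R by rewrite inE (rep_eq (f_rep g)).
    have ry : f (rep g) = y by rewrite f_rep gy.
    rewrite (bigD1 (rep g)) /= ?ry // ffunE rR ry addrC subr_eq0; apply/eqP/eq_bigr.
    move=> h /andP[/eqP hy ne]; rewrite ffunE (negbTE (notR (rep g) h rR _ ne)) //.
    by rewrite hy ry.
  move=> x z; rewrite !inE => /forallP x0 /forallP z0 /ffunP e; apply/ffunP=> g.
  have [gR|gR] := boolP (g \in R); last by have := e g; rewrite !ffunE (negbTE gR).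
  have := eqP (x0 (f g)); have := eqP (z0 (f g)).
  rewrite !(bigD1 (P := [pred h | f h == f g]) g) //=.
  move=> /(canRL (addrK _)) -> /(canRL (addrK _)) ->; rewrite !sub0r; congr (- _).
  apply: eq_bigr => h /andP[hg ne]; have := e h.
  by rewrite !ffunE (negbTE (notR g h gR hg ne)).
rewrite card_pffun_on -card_rep -expnD -(cardC (mem R)) addnC; congr (_ ^ (_ + _))%N.
Qed.

End FiberSums.

(** * Powers killed by trace forms *)

Lemma lrmorphism_inverse (R : comNzRingType) (A B : algType R) (f : {lrmorphism A -> B}) :
  bijective f -> exists g : {lrmorphism B -> A}, cancel f g /\ cancel g f.
Proof.
case=> g fK gK.
have gl : linear g by move=> a x y; apply: (can_inj fK); rewrite linearP /= !gK.
have gm : monoid_morphism g.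
  by split=> [|x y]; apply: (can_inj fK); rewrite ?rmorph1 ?rmorphM /= !gK.
pose gl1 := GRing.isLinear.Build R B A *:%R g gl.
pose gm1 := GRing.isMonoidMorphism.Build B A g gm.
pose gL : {lrmorphism B -> A} := HB.pack g gl1 gm1.
by exists gL.
Qed.

Section Nulls.

Variables (p : nat) (A : algType 'F_p).

Definition trace_null k (x : A) :=
  forall phi : {scalar A}, is_trace phi -> phi (x ^+ (p ^ k)) = 0.

(** For N = 1 this says that x^(p^k) lies in the ideal generated by commutators.
    Linear forms can be pulled back, so isomorphisms preserve this property. *)
Definition comm_null N k (x : A) :=
  forall phi : {scalar A}, is_trace phi -> kills_comm N phi -> phi (x ^+ (p ^ k)) = 0.

Definition is_central (x : A) := forall y, x * y = y * x.

End Nulls.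

Section NullTransport.

Variables (p : nat) (A B : algType 'F_p) (f : {lrmorphism A -> B}).

Lemma trace_pullback (phi : {scalar B}) : is_trace phi -> is_trace (phi \o f : {scalar A}).
Proof. by move=> phiC x y; rewrite /= !rmorphM phiC. Qed.

Lemma kills_comm_pullback N (phi : {scalar B}) :
  kills_comm N phi -> kills_comm N (phi \o f : {scalar A}).
Proof.
by move=> phiC t x y s; rewrite /= !(rmorphM, rmorphXn, rmorphB) /= phiC.
Qed.

Lemma trace_null_image k x : trace_null k x -> trace_null k (f x).
Proof.
by move=> nx phi phiC; rewrite -rmorphXn; apply: nx (trace_pullback phiC).
Qed.

Lemma comm_null_image N k x : comm_null N k x -> comm_null N k (f x).
Proof.
move=> nx phi phiC kphi; rewrite -rmorphXn.
exact: nx (trace_pullback phiC) (kills_comm_pullback kphi).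
Qed.

End NullTransport.

Section GroupNulls.

Variables (p : nat) (gT : finGroupType).
Hypothesis p_pr : prime p.
Local Notation A := (galg 'F_p gT).
Local Notation gelt := (gelt 'F_p).
Local Notation G' := ([set: gT]^`(1))%g.

Lemma trace_pow_extend (phi : {scalar A}) k (x : A) : is_trace phi ->
  phi (x ^+ (p ^ k)) = extend (fun g => phi (gelt (g ^+ (p ^ k))%g)) x.
Proof. exact: trace_pow. Qed.

(** For the direct implication, the coefficient at 1 is a trace form, and it is
    evaluated at (g - 1)^(p^k). *)
Lemma trace_null_exponent k :
  (forall x : A, aug x = 0 -> trace_null k x) <-> (forall g : gT, g ^+ (p ^ k) = 1)%g.
Proof.
split=> [null g | exp1 x x0 phi phiC].
  pose phi := extend (p := p) (fun u : gT => (u == 1%g)%:R).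
  have phiC : is_trace phi by apply: coef1_trace.
  have aug0 : aug (gelt g - gelt 1%g) = 0 by rewrite linearB /= !aug_gelt subrr.
  have := null _ aug0 phi phiC.
  rewrite trace_pow_extend // linearB /= !extend_gelt expg1n eqxx.
  by case: eqP => // _ /eqP; rewrite sub0r oppr_eq0 oner_eq0.
rewrite (trace_pow p_pr) //; rewrite (eq_bigr (fun g => x g * phi (gelt 1%g))).
  by rewrite -big_distrl /= -augE x0 mul0r.
by move=> g _; rewrite exp1.
Qed.

Lemma coset_der_eq (g h : gT) : (coset G' g == coset G' h) = ((g^-1 * h)%g \in G').
Proof.
have nG' u : u \in 'N(G')%g by apply: (subsetP (der_norm 1 [set: gT])); rewrite inE.
apply/eqP/idP=> [e | /coset_id].
  by apply: coset_idr; rewrite ?nG' // morphM ?morphV ?groupV ?nG' //= e mulVg.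
by rewrite morphM ?morphV ?groupV ?nG' //= => /eqP; rewrite -eq_mulVg1 => /eqP.
Qed.

(** The forms that vanish on the commutator ideal are the functions on the
    cosets of the derived subgroup. *)
Lemma comm_null1_fibers k (x : A) :
  comm_null 1 k x <->
  forall y, \sum_(g | coset G' (g ^+ (p ^ k))%g == y) x g = 0.
Proof.
split=> [null y | null phi phiC kphi].
  pose phi := extend (p := p) (fun g : gT => (coset G' g == y)%:R).
  have kphi : kills_comm 1 phi.
    by apply: extend_kills_comm1 => g h; rewrite -coset_der_eq => /eqP ->.
  have := null phi (kills_comm1_trace kphi) kphi.
  rewrite (trace_pow p_pr); last exact: kills_comm1_trace.
  move=> e; rewrite -[RHS]e [LHS]big_mkcond /=; apply: eq_bigr => g _; rewrite extend_gelt.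
  by case: eqP; rewrite ?mulr1 ?mulr0.
rewrite (trace_pow p_pr) // (partition_big (fun g => coset G' (g ^+ (p ^ k))%g) xpredT) //=.
rewrite big1 // => y _; have [h /= hy|none] := pickP (fun g => coset G' (g ^+ (p ^ k))%g == y).
  rewrite (eq_bigr (fun g => x g * phi (gelt (h ^+ (p ^ k))%g))).
    by rewrite -big_distrl /= null mul0r.
  move=> g gy; congr (_ * _); apply: kills_comm1_coset => //.
  by rewrite -coset_der_eq (eqP gy) (eqP hy).
by rewrite big_pred0.
Qed.

Definition comm_null1_set k : {set {ffun gT -> 'F_p}} :=
  zero_fiber_sums 'F_p (fun g : gT => coset G' (g ^+ (p ^ k))%g).

Lemma comm_null1_setP k (x : A) : reflect (comm_null 1 k x) (x \in comm_null1_set k).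
Proof.
rewrite inE; apply: (iffP forallP) => [h|/comm_null1_fibers h y].
  by apply/comm_null1_fibers => y; apply/eqP.
by apply/eqP.
Qed.

(** This is how the algebra knows the number of p^k-th powers in the
    abelianization. *)
Lemma card_comm_null1 k :
  (#|comm_null1_set k| * p ^ #|[set (q ^+ (p ^ k))%g | q in ([set: gT] / G')%g]|
    = p ^ #|gT|)%N.
Proof.
have := card_zero_fiber_sums 'F_p (fun g : gT => coset G' (g ^+ (p ^ k))%g).
rewrite card_Fp // => <-; congr (_ * p ^ #|pred_of_set _|)%N.
have nG' u : u \in 'N(G')%g by apply: (subsetP (der_norm 1 [set: gT])); rewrite inE.
apply/setP=> q; apply/imsetP/imsetP=> [[_ /morphimP[g _ gT_ ->] ->]|[g _ ->]].
  by exists g; rewrite // morphX.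
exists (coset G' g); last by rewrite /= morphX.
by apply: mem_quotient; rewrite inE.
Qed.

End GroupNulls.

(** * Central elements of a group algebra *)

Section CentralNulls.

Variables (p : nat) (gT : finGroupType).
Hypotheses (p_pr : prime p) (pG : p.-group [set: gT]%g).
Local Notation A := (galg 'F_p gT).
Local Notation gelt := (gelt 'F_p).
Local Notation G' := ([set: gT]^`(1))%g.
Local Notation Z := ('Z([set: gT]))%g.

(** The class of a noncentral element has length divisible by p. *)
Lemma sum_class_function (F : gT -> 'F_p) :
  (forall g h, F (g ^ h)%g = F g) -> \sum_g F g = \sum_(g in Z) F g.
Proof.
move=> Fconj; rewrite (sum_Fp_fixed_points (to := 'J) (F := F) p_pr pG).
  by apply: eq_bigl => g; rewrite afixJ /center setTI.
by move=> a w _; apply: Fconj.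
Qed.

Lemma is_central_conj (w : A) g h : is_central w -> w (g ^ h)%g = w g.
Proof.
move=> wC; have /ffunP/(_ (g * h)%g) := wC (gelt h).
rewrite gelt_mulE ffunE (bigD1 g) //= ffunE mulKg eqxx mulr1 big1 ?addr0.
  by move=> ->.
move=> k ne; rewrite ffunE (canF_eq (mulKVg k)) (inj_eq (mulIg h)) eq_sym.
by rewrite (negbTE ne) mulr0.
Qed.

Lemma coset_der_conj (g h : gT) : coset G' (g ^ h)%g = coset G' g.
Proof.
by apply/eqP; rewrite eq_sym coset_der_eq -commgEl mem_commg ?in_setT.
Qed.

(** By the trace formula only the central group elements contribute to the value
    at w^(p^k). Those in one coset of the derived subgroup have the same p^k-th
    power, and their coefficients add up to 0. *)
Lemma central_trace_null k (w : A) : is_central w -> comm_null 1 0 w ->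
    (forall u, u \in (Z :&: G')%g -> u ^+ (p ^ k) = 1)%g ->
  trace_null k w.
Proof.
move=> wC /comm_null1_fibers null exp1 phi phiC; rewrite trace_pow //.
have phi_conj g h : phi (gelt (g ^ h)%g) = phi (gelt g).
  by rewrite conjgE geltM phiC -geltM mulgK.
rewrite sum_class_function => [|g h]; last by rewrite is_central_conj // -conjXg phi_conj.
rewrite (partition_big (coset G') xpredT) //= big1 // => y _.
have [h /= /andP[hZ /eqP hy]|none] := pickP (fun g => (g \in Z) && (coset G' g == y)); last first.
  by rewrite big_pred0.
rewrite (eq_bigr (fun g => w g * phi (gelt (h ^+ (p ^ k))%g))) => [|g /andP[gZ gy]].
  rewrite -big_distrl /=.
  have -> : \sum_(g in Z | coset G' g == y) w g = \sum_(g | coset G' (g ^+ (p ^ 0))%g == y) w g.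
    rewrite big_mkcondr /= -sum_class_function => [|g u]; last first.
      by rewrite is_central_conj // coset_der_conj.
    by rewrite [RHS]big_mkcond; apply: eq_bigr => g _; rewrite expn0 expg1.
  by rewrite null // mul0r.
congr (_ * phi (gelt _)).
have uZG' : (h^-1 * g)%g \in (Z :&: G')%g.
  by rewrite inE groupM ?groupV //= -coset_der_eq hy eq_sym.
have cgh : commute h (h^-1 * g)%g.
  have /centerP[_ cZ] := hZ; apply: cZ; by rewrite inE.
by rewrite -{1}(mulKVg h g) expgMn // (exp1 _ uZG') mulg1.
Qed.

End CentralNulls.

(** * Abelianization and class of the second group *)

Section IsoTransfer.

Variables (p : nat) (gT hT : finGroupType).
Hypotheses (p_pr : prime p) (pG : p.-group [set: gT]%g) (pH : p.-group [set: hT]%g).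
Local Notation A := (galg 'F_p gT).
Local Notation B := (galg 'F_p hT).
Variables (f : {lrmorphism A -> B}) (f' : {lrmorphism B -> A}).
Hypotheses (fK : cancel f f') (f'K : cancel f' f).

(** A ring morphism to F_p maps an element of p-power order to one of p-power
    order in a group of order p - 1, so the augmentation is the only such
    morphism. *)
Lemma aug_lrmorphism x : aug (f x) = aug x.
Proof.
have [k cardG] := p_natP pG.
elim/galg_ind: x => [g|a x y IHx IHy]; last by rewrite !linearP /= IHx IHy.
rewrite aug_gelt -(Fp_pow_fixed p_pr (aug (f _)) k) -!rmorphXn -geltX.
by rewrite -cardG expg_cardG ?inE // gelt1 !rmorph1.
Qed.

Lemma iso_card : #|[set: gT]| = #|[set: hT]|.
Proof.
have : #|{: {ffun gT -> 'F_p}}| = #|{: {ffun hT -> 'F_p}}|.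
  by apply: (@bij_eq_card _ _ f); exists f'.
rewrite !card_ffun card_Fp // !cardsT => /eqP.
by rewrite eqn_exp2l ?prime_gt1 // => /eqP.
Qed.

Lemma iso_der_quotient_powers k :
  #|[set (q ^+ (p ^ k))%g | q in ([set: gT] / [set: gT]^`(1))%g]|
  = #|[set (q ^+ (p ^ k))%g | q in ([set: hT] / [set: hT]^`(1))%g]|.
Proof.
have cardE : #|comm_null1_set p gT k| = #|comm_null1_set p hT k|.
  pose fF : {ffun gT -> 'F_p} -> {ffun hT -> 'F_p} := f.
  rewrite -(@on_card_preimset _ _ fF (comm_null1_set p hT k)).
    apply: eq_card => x; rewrite [in RHS]inE.
    apply/(comm_null1_setP p_pr)/(comm_null1_setP p_pr) => [|/(comm_null_image f')].
      exact: comm_null_image.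
    by rewrite fK.
  by apply: onW_bij; exists f'.
have := card_comm_null1 gT p_pr k; rewrite cardE -cardsT iso_card cardsT.
rewrite -(card_comm_null1 hT p_pr k) => /eqP.
rewrite eqn_pmul2l ?eqn_exp2l ?prime_gt1 //; first by move/eqP.
apply/card_gt0P; exists 0; rewrite inE; apply/forallP=> y; rewrite big1 // => g _.
by rewrite ffunE.
Qed.

Let abG : abelian ([set: gT] / [set: gT]^`(1))%g := der_abelian 0 _.
Let abH : abelian ([set: hT] / [set: hT]^`(1))%g := der_abelian 0 _.

Lemma iso_card_der_quotient :
  #|([set: gT] / [set: gT]^`(1))%g| = #|([set: hT] / [set: hT]^`(1))%g|.
Proof.
have im (rT : finGroupType) (Q : {set rT}) : [set (q ^+ (p ^ 0))%g | q in Q] = Q.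
  by apply/setP=> x; apply/imsetP/idP => [[q qQ ->]|xQ] //; exists x.
by have := iso_der_quotient_powers 0; rewrite !im.
Qed.

Lemma iso_card_der : #|[set: gT]^`(1)%g| = #|[set: hT]^`(1)%g|.
Proof.
have := iso_card; rewrite -(Lagrange (der_sub 1 [set: gT])) -(Lagrange (der_sub 1 [set: hT])).
rewrite -!card_quotient ?der_norm // iso_card_der_quotient => /eqP.
by rewrite eqn_pmul2r ?cardG_gt0 // => /eqP.
Qed.

Lemma iso_rank_der_quotient :
  'r([set: gT] / [set: gT]^`(1))%g = 'r([set: hT] / [set: hT]^`(1))%g.
Proof.
have pQG := quotient_pgroup [set: gT]^`(1) pG.
have pQH := quotient_pgroup [set: hT]^`(1) pH.
rewrite (rank_pgroup pQG) (rank_pgroup pQH) !p_rank_abelian //; congr logn.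
have /eqP := iso_card_der_quotient.
rewrite -(mul_card_Ohm_Mho_abelian 1 abG) -(mul_card_Ohm_Mho_abelian 1 abH).
rewrite (MhoEabelian 1 pQG abG) (MhoEabelian 1 pQH abH) iso_der_quotient_powers.
rewrite eqn_pmul2r; first by move/eqP.
by apply/card_gt0P; exists 1%g; apply/imsetP; exists 1%g; rewrite ?group1 ?expg1n.
Qed.

Lemma iso_exponent_der_quotient k :
  (forall q, q \in ([set: gT] / [set: gT]^`(1))%g -> (q ^+ (p ^ k) = 1)%g) ->
  forall q, q \in ([set: hT] / [set: hT]^`(1))%g -> (q ^+ (p ^ k) = 1)%g.
Proof.
move=> exp1 q qQ.
have : (#|[set (q ^+ (p ^ k))%g | q in ([set: hT] / [set: hT]^`(1))%g]| <= 1)%N.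
  rewrite -iso_der_quotient_powers.
  apply: (@leq_trans #|[set (1%g : coset_of [set: gT]^`(1))]|); last by rewrite cards1.
  by apply/subset_leq_card/subsetP=> _ /imsetP[q' q'Q ->]; rewrite inE exp1.
move/card_le1_eqP => eq1; apply: eq1; last by apply: imset_f.
by apply/imsetP; exists 1%g; rewrite ?group1 ?expg1n.
Qed.

(** For r > 0, the element z = c - 1 is central, it lies in the commutator
    ideal, and z^(p^(r - 1)) is not killed by all trace forms. By
    [central_trace_null] the image of z in the other algebra can only have these
    properties if some central element of H' has order p^r, hence generates H'. *)
Lemma iso_class2 (c : gT) r : (forall g, commute g c) -> c \in ([set: gT]^`(1))%g ->
    #[c]%g = (p ^ r)%N -> #|[set: gT]^`(1)%g| = (p ^ r)%N ->
  ([set: hT]^`(1) \subset 'Z([set: hT]))%g.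
Proof.
move=> cC cG' oc cardG'.
case: r oc cardG' => [|r] oc cardG'.
  have /eqP : #|[set: hT]^`(1)%g| = 1%N by rewrite -iso_card_der cardG'.
  by rewrite -trivg_card1 => /eqP ->; apply: sub1G.
pose z := gelt 'F_p c - 1.
have zC : is_central z.
  move=> x; elim/galg_ind: x => [g|a x y IHx IHy].
    by rewrite mulrBl mulrBr mul1r mulr1 -!geltM cC.
  by rewrite [z * _]mulrDr [_ * z]mulrDl -scalerAr -scalerAl IHx IHy.
have fzC : is_central (f z).
  by move=> y; rewrite -(f'K y) -!rmorphM zC.
have z_null : comm_null 1 0 z.
  move=> phi phiC kphi; rewrite expn0 expr1 linearB /= -gelt1.
  by rewrite (kills_comm1_coset (g := c) (h := 1%g) kphi) ?subrr // mulg1 groupV.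
have z_not_null : ~ trace_null r z.
  pose phi := extend (p := p) (fun u : gT => (u == 1%g)%:R).
  have phiC : is_trace phi by apply: coef1_trace.
  move=> /(_ phi phiC); rewrite trace_pow_extend // linearB /= -gelt1 !extend_gelt expg1n eqxx.
  rewrite -order_dvdn oc dvdn_Pexp2l ?prime_gt1 // ltnn sub0r => /eqP.
  by rewrite oppr_eq0 oner_eq0.
have [/existsP[h /andP[hZH' h_ne1]]|/existsPn all1] :=
    boolP [exists h, (h \in 'Z([set: hT]) :&: [set: hT]^`(1))%g && (h ^+ (p ^ r) != 1)%g].
  have {hZH'} [hZ hH'] := setIP hZH'.
  have oh : #[h]%g = (p ^ r.+1)%N.
    have : (#[h]%g %| p ^ r.+1)%N by rewrite -cardG' iso_card_der order_dvdG.
    case/(dvdn_pfactor _ _ p_pr) => e le_e oh; rewrite oh; congr (_ ^ _)%N.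
    apply/eqP; rewrite eqn_leq le_e /= ltnNge; apply: contra h_ne1 => le_er.
    by rewrite -order_dvdn oh dvdn_exp2l.
  have -> : [set: hT]^`(1)%g = <[h]>%g.
    apply/eqP; rewrite eq_sym eqEcard cycle_subG hH' /=.
    by rewrite -orderE oh -iso_card_der cardG'.
  by rewrite cycle_subG.
have : trace_null r (f z).
  apply: central_trace_null => //; first exact: comm_null_image.
  by move=> u uZ; have := all1 u; rewrite uZ /= negbK => /eqP.
by move/(trace_null_image f'); rewrite fK.
Qed.

End IsoTransfer.

(** * The commutator ideal in class two *)

Lemma gelt_sub1_Xp p (gT : finGroupType) (g : gT) l : prime p ->
  (gelt 'F_p g - 1) ^+ (p ^ l) = gelt 'F_p (g ^+ (p ^ l))%g - 1.
Proof.
move=> p_pr; have pA : p \in [pchar (galg 'F_p gT)] by rewrite pchar_lalg pchar_Fp.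
elim: l => [|l IHl]; first by rewrite !expr1.
rewrite expnSr exprM IHl -(pFrobenius_autE pA) pFrobenius_autB_comm ?pFrobenius_aut1.
  by rewrite pFrobenius_autE -geltX expgM.
exact: commr1.
Qed.

Section Class2Algebra.

Variables (p m n r i j : nat) (gT : finGroupType) (a b : gT).
Hypotheses (p_pr : prime p) (D : class2_pair p m n r i j a b).
Local Notation A := (galg 'F_p gT).
Local Notation gelt := (gelt 'F_p).
Local Notation c := [~ a, b]%g.
Local Notation G' := ([set: gT]^`(1))%g.
Let p_gt0 : (0 < p)%N. Proof. exact: prime_gt0. Qed.

Definition c_minus1 : A := gelt c - 1.
Local Notation z := c_minus1.

Lemma c_minus1_central : is_central z.
Proof.
rewrite /z; move=> x; elim/galg_ind: x => [g|k x y IHx IHy].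
  by rewrite mulrBl mulrBr mul1r mulr1 -!geltM (c2_cent D g).
by rewrite [_ * (_ + _)]mulrDr [RHS]mulrDl -scalerAr -scalerAl IHx IHy.
Qed.

Lemma c_minus1_comm : z = gelt (b * a)^-1%g * (gelt a * gelt b - gelt b * gelt a).
Proof.
rewrite mulrBr -!geltM mulVg gelt1; congr (gelt _ - _).
by rewrite invMg commgEl conjgE !mulgA.
Qed.

(** Together with [c_minus1_comm]: the central element c - 1 generates the
    commutator ideal. *)
Lemma comm_c_minus1 t x y : exists w, t * (x * y - y * x) = z * w.
Proof.
suff [w ->] : exists w, x * y - y * x = z * w.
  by exists (t * w); rewrite mulrA -c_minus1_central mulrA.
elim/galg_ind: x => [g|k x x' [w e] [w' e']]; last first.
  exists (k *: w + w'); rewrite mulrDl [y * (_ + _)]mulrDr -scalerAl -scalerAr opprD addrACA.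
  by rewrite -scalerBr e e' [RHS]mulrDr -scalerAr.
elim/galg_ind: y => [h|k x x' [w e] [w' e']]; last first.
  exists (k *: w + w'); rewrite mulrDl mulrDr -scalerAl -scalerAr opprD addrACA.
  by rewrite -scalerBr e e' [RHS]mulrDr -scalerAr.
have [e he] := c2_comm_mem p_gt0 D g h.
exists ((\sum_(k < e) gelt c ^+ k) * gelt (h * g)%g).
rewrite mulrA -subrX1 mulrBl mul1r -geltX -!geltM -he; congr (gelt _ - _).
by rewrite commgC he (c2_centX D e).
Qed.

Lemma c_minus1_Xp l : z ^+ (p ^ l) = gelt (c ^+ (p ^ l))%g - 1.
Proof. exact: gelt_sub1_Xp. Qed.

Lemma comm_pow_c_minus1 l t x y s :
  exists w, (t * (x * y - y * x)) ^+ (p ^ l) * s = (gelt (c ^+ (p ^ l))%g - 1) * w.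
Proof.
have [w ->] := comm_c_minus1 t x y; exists (w ^+ (p ^ l) * s).
by rewrite exprMn_comm ?c_minus1_Xp ?mulrA //; apply: c_minus1_central.
Qed.

Lemma kills_comm_mulc l (phi : {scalar A}) e u : kills_comm (p ^ l) phi ->
  phi (gelt (c ^+ (p ^ l * e) * u)%g) = phi (gelt u).
Proof.
move=> kphi; elim: e => [|e IHe]; first by rewrite muln0 expg0 mul1g.
have := kphi (gelt (b * a)^-1%g) (gelt a) (gelt b) (gelt (c ^+ (p ^ l * e) * u)%g).
rewrite -c_minus1_comm c_minus1_Xp mulrBl mul1r -geltM linearB /= => /eqP.
by rewrite IHe subr_eq0 mulgA -expgD mulnS => /eqP.
Qed.

Lemma extend_kills_comm l (v : gT -> 'F_p) :
  (forall u, v (c ^+ (p ^ l) * u)%g = v u) -> kills_comm (p ^ l) (extend v).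
Proof.
move=> vc t x y s; have [w ->] := comm_pow_c_minus1 l t x y s.
rewrite mulrBl mul1r linearB /=; apply/eqP; rewrite subr_eq0; apply/eqP.
elim/galg_ind: w => [g|k w w' IHw IHw']; first by rewrite -geltM !extend_gelt vc.
by rewrite mulrDr -scalerAr !linearP /= IHw IHw'.
Qed.

Lemma c2_der u : u \in G' -> exists e, u = (c ^+ e)%g.
Proof.
suff sub : G' \subset <[c]>%g by move/(subsetP sub)/cycleP.
rewrite gen_subG; apply/subsetP=> _ /imset2P[g h _ _ ->].
by have [e ->] := c2_comm_mem p_gt0 D g h; apply: mem_cycle.
Qed.

(** For the direct implication, differences of two group elements suffice, and
    since p^n-th powers are central the indicator function of a coset of
    <c^(p^l)> that contains one of them is a trace form. Conversely, the
    coefficients of x add up to 0 over all g whose p^n-th powers agree modulo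
    the derived subgroup. *)
Lemma comm_null_power_sep l : (r <= n)%N ->
  (forall x : A, comm_null 1 n x -> comm_null (p ^ l) n x) <->
  (forall (g h : gT) e, g ^+ (p ^ n) = h ^+ (p ^ n) * c ^+ e ->
        exists e', g ^+ (p ^ n) = h ^+ (p ^ n) * c ^+ (p ^ l * e'))%g.
Proof.
move=> le_rn; set N := (p ^ n)%N.
have powC (g h : gT) : commute (g ^+ N)%g h.
  apply/commgP; have [e he] := c2_comm_mem p_gt0 D g h.
  rewrite commXg he; last exact: c2_centX D _ _.
  by rewrite -expgM -order_dvdn (c2_order D) dvdn_mull // dvdn_exp2l.
split=> [null g h e egh | sep x null phi phiC kphi].
  pose v u : 'F_p := ((h ^+ N)^-1 * u \in <[c ^+ (p ^ l)]>)%g%:R.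
  have phiC : is_trace (extend v).
    apply: extend_trace => u w; rewrite /v; congr (nat_of_bool _)%:R.
    have -> : ((h ^+ N)^-1 * (w * u) = ((h ^+ N)^-1 * (u * w)) ^ u)%g.
      rewrite conjMg conjVg (conjg_fixP _) ?mulKg; last exact/commgP.
      by rewrite conjgE -mulgA mulKg.
    rewrite memJ_norm // (subsetP (cent_sub _)) // cent_cycle.
    by apply/cent1P; apply: c2_centX D _ _.
  have kphi : kills_comm (p ^ l) (extend v).
    apply: extend_kills_comm => u; rewrite /v; congr (nat_of_bool _)%:R.
    by rewrite mulgA (c2_centX D) -mulgA groupMl ?cycle_id.
  have null_gh : comm_null 1 n (gelt g - gelt h).
    move=> phi phi_tr kphi1; rewrite trace_pow_extend // linearB /= !extend_gelt.
    rewrite (kills_comm1_coset (g := (g ^+ N)%g) (h := (h ^+ N)%g)) ?subrr //.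
    by rewrite /N egh invMg mulgKV groupV groupX // mem_commg ?inE.
  have := null _ null_gh _ phiC kphi.
  rewrite trace_pow_extend // linearB /= !extend_gelt /v mulVg group1.
  case: (boolP (_ \in _)) => [/cycleP[e' he'] _ | _ /eqP]; last first.
    by rewrite sub0r oppr_eq0 oner_eq0.
  by exists e'; rewrite expgM -he' mulKVg.
rewrite (trace_pow p_pr) // (partition_big (fun g => coset G' (g ^+ N)%g) xpredT) //=.
rewrite big1 // => y _.
have [h /= hy|none] := pickP (fun g => coset G' (g ^+ N)%g == y); last first.
  by rewrite big_pred0.
rewrite (eq_bigr (fun g => x g * phi (gelt (h ^+ N)%g))) => [|g gy].
  by rewrite -big_distrl /= ((comm_null1_fibers p_pr n x).1 null) mul0r.
congr (_ * _); have : ((h ^+ N)^-1 * g ^+ N)%g \in G' by rewrite -coset_der_eq (eqP hy) eq_sym.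
case/c2_der=> e he; have [|e' ->] := sep g h e; first by rewrite -he mulKVg.
by rewrite (c2_centX D) kills_comm_mulc.
Qed.

End Class2Algebra.

(** * Powers of two in characteristic two *)

Section CharTwo.

Variables (m r i j : nat) (gT : finGroupType) (a b : gT).
Hypotheses (r_gt0 : (0 < r)%N) (le_rm : (r <= m)%N).
Hypothesis D : class2_pair 2 m r r i j a b.
Local Notation A := (galg 'F_2 gT).
Local Notation gelt := (gelt 'F_2).
Local Notation c := [~ a, b]%g.
Local Notation z := (c_minus1 2 a b).
Variables X Y : gT -> bool.
Hypothesis XY_parity : forall x y k,
  X (a ^+ x * b ^+ y * c ^+ k)%g = odd x /\ Y (a ^+ x * b ^+ y * c ^+ k)%g = odd y.

Let two_pr : prime 2 := isT.
Let two_gt0 : (0 < 2)%N. Proof. by []. Qed.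

Lemma oppA2 (x : A) : - x = x.
Proof. by apply: oppr_pchar2; rewrite pchar_lalg pchar_Fp. Qed.

Lemma add2 (v : 'F_2) : v + v = 0.
Proof. by apply: addrr_pchar2; rewrite pchar_Fp. Qed.

Lemma F2_cases (v : 'F_2) : v = 0 \/ v = 1.
Proof. by case: v => [[|[|//]] ?]; [left | right]; apply/val_inj. Qed.

Lemma sqr2 (v : 'F_2) : v * v = v.
Proof. by case: (F2_cases v) => ->; rewrite ?mulr0 ?mulr1. Qed.

Lemma natr_odd k : k%:R = (odd k)%:R :> 'F_2.
Proof. by rewrite -modn2 Fp_nat_mod. Qed.

Lemma galg2_ind (P : A -> Prop) :
  (forall g, P (gelt g)) -> (forall x y, P x -> P y -> P (x + y)) -> forall x, P x.
Proof.
move=> Pg PD; apply: galg_ind => // v x y Px Py.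
by case: (F2_cases v) => ->; rewrite ?scale0r ?add0r ?scale1r //; apply: PD.
Qed.

(** The part of x^(2^k) that is linear in x. *)
Definition upow k (x : A) : A := \sum_g x g *: gelt (g ^+ (2 ^ k))%g.

Lemma upowD k x y : upow k (x + y) = upow k x + upow k y.
Proof.
by rewrite /upow -big_split; apply: eq_bigr => g _; rewrite galg_addE scalerDl.
Qed.

Lemma upow_gelt k g : upow k (gelt g) = gelt (g ^+ (2 ^ k))%g.
Proof.
rewrite /upow (bigD1 g) //= ffunE eqxx scale1r big1 ?addr0 // => h /negbTE ne.
by rewrite ffunE ne scale0r.
Qed.

Lemma upow0 x : upow 0 x = x.
Proof. by rewrite [RHS]galg_sum; apply: eq_bigr => g _; rewrite expn0 expg1. Qed.

Let zC : is_central z := c_minus1_central D.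

Lemma zXC k x : z ^+ k * x = x * z ^+ k.
Proof. by apply/esym/commrX; rewrite /GRing.comm zC. Qed.

(** The commutator of a 2^k-th and a 2^l-th power is the 2^(k + l)-th power of a
    commutator. *)
Lemma upow_comm k l x y : exists t,
  upow k x * upow l y + upow l y * upow k x = z ^+ (2 ^ (k + l)) * t.
Proof.
elim/galg2_ind: x => [g|x x' [t e] [t' e']]; last first.
  by exists (t + t'); rewrite upowD mulrDl [_ * (upow k x + _)]mulrDr addrACA e e' mulrDr.
elim/galg2_ind: y => [h|y y' [t e] [t' e']]; last first.
  by exists (t + t'); rewrite upowD mulrDr [(upow l y + _) * _]mulrDl addrACA e e' mulrDr.
rewrite !upow_gelt -!geltM.
have [e he] := c2_comm_mem two_gt0 D g h.
have [cg ch] : commute g [~ g, h]%g /\ commute h [~ g, h]%g.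
  by rewrite he; split; apply: c2_centX D _ _.
rewrite [(g ^+ _ * _)%g]commgC commXXg // he -!expgM -expnD.
set u := (h ^+ _ * g ^+ _)%g; set k2 := (2 ^ _)%N.
exists ((\sum_(q < e) (gelt (c ^+ k2)%g) ^+ q) * gelt u).
rewrite (c_minus1_Xp _ _ two_pr) mulrA -subrX1 mulrBl mul1r -geltX -geltM -expgM.
by rewrite oppA2 mulnC (c2_centX D).
Qed.

Local Notation eX := (extend (fun g => (X g)%:R)).
Local Notation eY := (extend (fun g => (Y g)%:R)).
Local Notation eXY := (extend (fun g => (X g && Y g)%:R)).

(** Since [~ g, h] = c^e with e = X g Y h - X h Y g modulo 2, the augmentation
    of the cofactor s is the alternating form of the coordinates modulo 2. *)
Lemma comm_aug x y : exists s, x * y + y * x = z * s /\ aug s = eX x * eY y + eX y * eY x.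
Proof.
elim/galg2_ind: x => [g|x x' [t [e1 e2]] [t' [e1' e2']]]; last first.
  exists (t + t'); rewrite mulrDl [y * (x + _)]mulrDr addrACA e1 e1' mulrDr; split=> //.
  by rewrite !linearD /= e2 e2' mulrDl mulrDr addrACA.
elim/galg2_ind: y => [h|y y' [t [e1 e2]] [t' [e1' e2']]]; last first.
  exists (t + t'); rewrite mulrDr [(y + _) * _]mulrDl addrACA e1 e1' mulrDr; split=> //.
  by rewrite !linearD /= e2 e2' mulrDl mulrDr addrACA.
have [x [y [k eg]]] := c2_normal_form two_gt0 D g.
have [x' [y' [k' eh]]] := c2_normal_form two_gt0 D h.
have := c2_comm_normal_form two_gt0 D x y k x' y' k'; rewrite -eg -eh; set e := (_ + _)%N => he.
exists ((\sum_(q < e) gelt c ^+ q) * gelt (h * g)%g); split.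
  rewrite mulrA -subrX1 mulrBl mul1r -geltX -!geltM -(c2_centX D) oppA2; congr (gelt _ + _).
  by rewrite commgC he.
rewrite !extend_gelt rmorphM /= aug_gelt mulr1 rmorph_sum /=.
rewrite (eq_bigr (fun=> 1)) => [|q _]; last first.
  by rewrite rmorphXn /= aug_gelt expr1n.
have [-> ->] : X g = odd x /\ Y g = odd y by rewrite eg; apply: XY_parity.
have [-> ->] : X h = odd x' /\ Y h = odd y' by rewrite eh; apply: XY_parity.
rewrite sumr_const card_ord (natr_odd e) /e oddD !oddM.
have -> : odd (2 ^ r).-1.
  by rewrite -(prednK r_gt0) expnS mul2n -subn1 oddB ?odd_double // double_gt0 expn_gt0.
by case: (odd x); case: (odd y); case: (odd x'); case: (odd y'); apply/val_inj.
Qed.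

Lemma upow_sqr k x : exists t, upow k x * upow k x = upow k.+1 x + z ^+ (2 ^ (k + k)) * t.
Proof.
elim/galg2_ind: x => [g|x y [t e] [t' e']].
  by exists 0; rewrite !upow_gelt mulr0 addr0 -geltM -expgD addnn -muln2 -expnSr.
have [t2 e2] := upow_comm k k x y; exists (t + t' + t2).
rewrite !upowD mulrDl !mulrDr [upow k y * upow k x + _]addrC addrACA e e' e2.
by rewrite [_ + _ * t + _]addrACA -!addrA.
Qed.

(** This quadratic form vanishes on group elements, and its polar form is the
    one in [comm_aug]. *)
Definition qform (x : A) : 'F_2 := eX x * eY x + eXY x.

Lemma sqr_upow x : exists s, x * x = upow 1 x + z * s /\ aug s = qform x.
Proof.
elim/galg2_ind: x => [g|x y [t [e1 e2]] [t' [e1' e2']]].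
  exists 0; rewrite mulr0 addr0 upow_gelt expn1 expgS expg1 geltM linear0; split=> //.
  rewrite /qform !extend_gelt -natrM mulnb; exact/esym/add2.
have [s [es1 es2]] := comm_aug x y; exists (t + t' + s); split.
  rewrite upowD mulrDl !mulrDr [y * x + _]addrC addrACA es1 e1 e1'.
  by rewrite [_ + _ * t + _]addrACA -!addrA.
rewrite !linearD /= e2 e2' es2 /qform !linearD /= mulrDl !mulrDr; ring.
Qed.

(** Squaring z^M s gives z^(2 M) s^2, and every other correction carries z to a
    power above 2 M, so the augmentation of the cofactor does not change from
    one step to the next. *)
Lemma pow2_upow k x : exists s,
  x ^+ (2 ^ k.+1) = upow k.+1 x + z ^+ (2 ^ k) * s /\ aug s = qform x.
Proof.
elim: k => [|k [s [es qs]]].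
  by have [s [es qs]] := sqr_upow x; exists s; rewrite expn0 expr1 -es.
have [t et] := upow_sqr k.+1 x; have [t' et'] := upow_comm k.+1 0 x s.
exists (z ^+ (2 ^ (k.+1 + k.+1) - 2 ^ k.+1) * t + z ^+ (2 ^ k) * t' + s * s).
have aug_z l : (0 < l)%N -> aug (z ^+ l) = 0.
  move=> l_gt0; rewrite rmorphXn /= linearB /= aug_gelt rmorph1 subrr expr0n.
  by rewrite (gtn_eqF l_gt0).
split; last first.
  rewrite !linearD /= !rmorphM /= !aug_z ?expn_gt0 // ?mul0r ?add0r ?qs ?sqr2 //.
  by rewrite subn_gt0 ltn_exp2l // -addn1 leq_add2l.
rewrite upow0 in et'.
rewrite expnSr exprM es expr2 mulrDl !mulrDr [_ * upow k.+1 x + _]addrC addrACA et.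
have -> : upow k.+1 x * (z ^+ (2 ^ k) * s) + z ^+ (2 ^ k) * s * upow k.+1 x
    = z ^+ (2 ^ k.+1) * (z ^+ (2 ^ k) * t').
  have -> : upow k.+1 x * (z ^+ (2 ^ k) * s) = z ^+ (2 ^ k) * (upow k.+1 x * s).
    by rewrite mulrA -zXC mulrA.
  by rewrite -[z ^+ _ * s * _]mulrA -mulrDr et' addn0 !mulrA -!exprD addnC.
have -> : z ^+ (2 ^ k) * s * (z ^+ (2 ^ k) * s) = z ^+ (2 ^ k.+1) * (s * s).
  by rewrite -mulrA [s * (_ * _)]mulrA -zXC !mulrA -exprD addnn -muln2 -expnSr.
have -> : z ^+ (2 ^ (k.+1 + k.+1)) * t
    = z ^+ (2 ^ k.+1) * (z ^+ (2 ^ (k.+1 + k.+1) - 2 ^ k.+1) * t).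
  by rewrite mulrA -exprD subnKC // leq_exp2l ?leq_addr.
rewrite -!addrA addrCA; congr (_ + _).
by rewrite addrA [_ * (_ * t') + _]addrC -addrA.
Qed.

End CharTwo.

(** * Invariants of the exceptional 2-groups *)

Section CommutatorPowers.

Variables (p : nat) (gT : finGroupType).
Local Notation A := (galg 'F_p gT).

(** If a central element z of the form t (x x' - x' x) generates the commutator
    ideal, these are the multiples of z^N; the next predicate asks for a
    cofactor of augmentation 0. *)
Definition comm_pow_multiple N (y : A) :=
  exists t x x' d : A, y = (t * (x * x' - x' * x)) ^+ N * d.

Definition comm_pow_aug_multiple N (y : A) :=
  exists t x x' d : A, aug d = 0 /\ y = (t * (x * x' - x' * x)) ^+ N * d.

(** With N = 2^(r - 1) and k = 2^r, this separates (s, t) = (r, r), where it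
    holds, from (r, r - 1) when r = n < m. *)
Definition multiples_are_aug N k :=
  forall x : A, aug x = 0 -> comm_pow_multiple N (x ^+ k) -> comm_pow_aug_multiple N (x ^+ k).

(** With N = 2^(r - 1) and k = 2^r, this separates the generalization of Q_8,
    where it holds, from that of D_8. *)
Definition aug_multiples_additive N k :=
  forall x y : A, aug x = 0 -> aug y = 0 ->
    comm_pow_aug_multiple N (x ^+ k) -> comm_pow_aug_multiple N (y ^+ k) ->
  comm_pow_aug_multiple N ((x + y) ^+ k).

End CommutatorPowers.

Section Exceptional.

Variables (m r i j : nat) (gT : finGroupType) (a b : gT).
Hypotheses (r_gt0 : (0 < r)%N) (le_rm : (r <= m)%N).
Hypothesis D : class2_pair 2 m r r i j a b.
Local Notation A := (galg 'F_2 gT).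
Local Notation gelt := (gelt 'F_2).
Local Notation c := [~ a, b]%g.
Local Notation z := (c_minus1 2 a b).
Local Notation w := (c ^+ (2 ^ r.-1))%g.
Local Notation W := (gelt w - 1).
Local Notation N := (2 ^ r.-1)%N.

Let two_pr : prime 2 := isT.
Let two_gt0 : (0 < 2)%N. Proof. by []. Qed.

Lemma comm_pow_multipleP y : comm_pow_multiple N y <-> exists d, y = W * d.
Proof.
split=> [[t [x [x' [d ->]]]] | [d ->]]; first exact: comm_pow_c_minus1 two_pr D _ _ _ _ _.
exists (gelt (b * a)^-1%g), (gelt a), (gelt b), d.
by rewrite -c_minus1_comm (c_minus1_Xp _ _ two_pr).
Qed.

Lemma comm_pow_aug_multipleP y :
  comm_pow_aug_multiple N y <-> exists d, aug d = 0 /\ y = W * d.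
Proof.
split=> [[t [x [x' [d [d0 ->]]]]] | [d [d0 ->]]].
  have [v ->] := comm_c_minus1 two_pr D t x x'; exists (v ^+ N * d).
  rewrite rmorphM /= d0 mulr0; split=> //.
  rewrite exprMn_comm; last exact: c_minus1_central D _.
  by rewrite (c_minus1_Xp _ _ two_pr) mulrA.
exists (gelt (b * a)^-1%g), (gelt a), (gelt b), d; split=> //.
by rewrite -c_minus1_comm (c_minus1_Xp _ _ two_pr).
Qed.

Lemma w_order2 : (w * w = 1)%g /\ (w != 1)%g.
Proof.
split; first by rewrite -expgD addnn -muln2 -expnSr prednK // (c2_exp D).
rewrite -order_dvdn (c2_order D) dvdn_Pexp2l // -ltnNge prednK //.
Qed.

Lemma W_mulE d g : (W * d) g = d (w * g)%g - d g.
Proof.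
have [ww _] := w_order2; have wV : (w^-1 = w)%g by apply/eqP; rewrite eq_invg_mul ww.
by rewrite mulrBl mul1r galg_addE gelt_mulE wV ffunE.
Qed.

(** The coefficients of d are constant on the cosets of {1, w}, and these have
    two elements. *)
Lemma W_mul0_aug d : W * d = 0 -> aug d = 0.
Proof.
move=> Wd; have [ww w1] := w_order2.
have d_inv g : d (g * w)%g = d g.
  rewrite (c2_centX D); have := W_mulE d g; rewrite Wd ffunE => /eqP.
  by rewrite eq_sym subr_eq0 => /eqP.
rewrite augE (sum_Fp_fixed_points (to := 'R) (G := <[w]>%G) two_pr) /=.
- rewrite big_pred0 // => g; apply/negP=> /afixP/(_ w (cycle_id _))/(canRL (mulKg g)).
  by rewrite mulVg; apply/eqP.
- apply: (@pnat_dvd _ 2); last by [].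
  by rewrite -orderE order_dvdn expgS expg1 ww.
move=> _ g /cycleP[k ->]; rewrite /mulgr_action /=.
by elim: k g => [|k IHk] g; rewrite ?mulg1 // expgS mulgA IHk d_inv.
Qed.

Lemma aug_multiple_W d : comm_pow_aug_multiple N (W * d) <-> aug d = 0.
Proof.
split=> [/comm_pow_aug_multipleP[d' [d'0 e]] | d0].
  have : W * (d - d') = 0 by rewrite mulrBr e subrr.
  by move/W_mul0_aug; rewrite linearB /= d'0 subr0.
by apply/comm_pow_aug_multipleP; exists d.
Qed.

(** The element b - 1 is a counterexample: its 2^r-th power is w - 1, with
    cofactor 1. *)
Lemma not_multiples_are_aug : (b ^+ (2 ^ r) = w)%g -> ~ multiples_are_aug 2 gT N (2 ^ r).
Proof.
move=> bw h; have x0 : aug (gelt b - 1) = 0 by rewrite linearB /= aug_gelt rmorph1 subrr.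
have pow_b : (gelt b - 1) ^+ (2 ^ r) = W * 1 by rewrite mulr1 -bw gelt_sub1_Xp.
have := h _ x0; rewrite pow_b => aug1.
have /aug_multiple_W : comm_pow_aug_multiple N (W * 1).
  by apply: aug1; apply/comm_pow_multipleP; exists 1.
by rewrite rmorph1 => /eqP; rewrite oner_eq0.
Qed.

Variables X Y : gT -> bool.
Hypothesis XY_parity : forall x y k,
  X (a ^+ x * b ^+ y * c ^+ k)%g = odd x /\ Y (a ^+ x * b ^+ y * c ^+ k)%g = odd y.
Local Notation eX := (extend (p := 2) (fun g => (X g)%:R)).
Local Notation eY := (extend (p := 2) (fun g => (Y g)%:R)).
Local Notation eXY := (extend (p := 2) (fun g => (X g && Y g)%:R)).

Lemma pow_r x : exists s, x ^+ (2 ^ r) = upow r x + W * s /\ aug s = eX x * eY x + eXY x.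
Proof.
have [s [es qs]] := pow2_upow r_gt0 D XY_parity r.-1 x.
by exists s; rewrite -(c_minus1_Xp _ _ two_pr) -{1 2}(prednK r_gt0).
Qed.

Lemma w_bool (e : bool) : gelt (w ^+ e)%g = 1 + e%:R *: W.
Proof.
move: w => u; case: e; last by rewrite scale0r addr0 -gelt1.
by rewrite -[LHS]/(gelt u) scale1r addrC subrK.
Qed.

(** All of x^(2^r), including its linear part, is now a multiple of W, and the
    augmentation of the cofactor is a quadratic form in the coordinates of x
    modulo 2. *)
Lemma aug_multiple_pow (kappa : gT -> bool) x :
    (forall g : gT, g ^+ (2 ^ r) = w ^+ kappa g)%g -> aug x = 0 ->
  comm_pow_aug_multiple N (x ^+ (2 ^ r)) <->
  extend (p := 2) (fun g => (kappa g)%:R) x + eX x * eY x + eXY x = 0.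
Proof.
move=> kE x0; have [s [-> qs]] := pow_r x.
have -> : upow r x = W * (extend (p := 2) (fun g => (kappa g)%:R) x)%:A.
  rewrite /upow (eq_bigr (fun g => x g *: 1 + (x g * (kappa g)%:R) *: W)) => [|g _].
    by rewrite big_split /= -!scaler_suml -augE x0 scale0r add0r -scalerAr mulr1.
  by rewrite kE w_bool scalerDr scalerA.
rewrite -mulrDr aug_multiple_W linearD /= linearZ /= rmorph1 qs addrA.
by rewrite /GRing.scale /= mulr1.
Qed.

(** The quadratic form is X + Y + X Y. It is anisotropic, so it vanishes only
    where X = Y = 0. *)
Lemma additive_quaternion : (forall g : gT, g ^+ (2 ^ r) = w ^+ (X g || Y g))%g ->
  aug_multiples_additive 2 gT N (2 ^ r).
Proof.
move=> kE x y x0 y0.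
have orE u : extend (p := 2) (fun g => (X g || Y g)%:R) u + eX u * eY u + eXY u
    = eX u + eY u + eX u * eY u :> 'F_2.
  have -> : extend (p := 2) (fun g => (X g || Y g)%:R) u = eX u + eY u + eXY u.
    rewrite /extend -!big_split; apply: eq_bigr => g _ /=; rewrite -!mulrDr; congr (_ * _).
    by case: (X g); case: (Y g); apply/val_inj.
  by rewrite addrAC -[_ + eXY u + eXY u]addrA add2 addr0.
have zero u v : u + v + u * v = 0 :> 'F_2 -> u = 0 /\ v = 0.
  by case: (F2_cases u) => ->; case: (F2_cases v) => ->.
move=> /(aug_multiple_pow kE x0); rewrite orE => /zero[Xx Yx].
move=> /(aug_multiple_pow kE y0); rewrite orE => /zero[Xy Yy].
have xy0 : aug (x + y) = 0 by rewrite linearD /= x0 y0 addr0.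
apply/(aug_multiple_pow kE xy0).
by rewrite orE !linearD /= Xx Yx Xy Yy !(addr0, mulr0).
Qed.

(** The quadratic form is X Y. It vanishes at a - 1 and at b - 1 but not at
    their sum. *)
Lemma not_additive_dihedral : (forall g : gT, g ^+ (2 ^ r) = w ^+ (X g && Y g))%g ->
  ~ aug_multiples_additive 2 gT N (2 ^ r).
Proof.
move=> kE h.
have [Xa Ya] : X a = true /\ Y a = false.
  by have := XY_parity 1 0 0; rewrite expg1 !expg0 !mulg1.
have [Xb Yb] : X b = false /\ Y b = true.
  by have := XY_parity 0 1 0; rewrite expg1 !expg0 !mulg1 mul1g.
have [X1 Y1] : X 1%g = false /\ Y 1%g = false.
  by have := XY_parity 0 0 0; rewrite !expg0 !mulg1.
have aug0 (g : gT) : aug (gelt g - gelt 1%g) = 0 by rewrite linearB /= !aug_gelt subrr.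
have powE u : aug u = 0 -> comm_pow_aug_multiple N (u ^+ (2 ^ r)) <-> eX u * eY u = 0.
  move=> u0; rewrite (aug_multiple_pow kE u0).
  by rewrite [_ + eX u * _]addrC -addrA add2 addr0.
have sub0 g u v : X g = u -> Y g = v ->
    eX (gelt g - gelt 1%g) = u%:R /\ eY (gelt g - gelt 1%g) = v%:R.
  by move=> Xg Yg; rewrite !linearB /= !extend_gelt Xg Yg X1 Y1 !subr0.
have [eXa eYa] := sub0 a _ _ Xa Ya; have [eXb eYb] := sub0 b _ _ Xb Yb.
have ab0 : aug (gelt a - gelt 1%g + (gelt b - gelt 1%g)) = 0 by rewrite linearD /= !aug0 addr0.
have := (powE _ ab0).1 (h _ _ (aug0 a) (aug0 b) ((powE _ (aug0 a)).2 _) ((powE _ (aug0 b)).2 _)).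
rewrite !(linearD _ (gelt a - gelt 1%g) (gelt b - gelt 1%g)) /= eXa eYa eXb eYb.
rewrite mulr0 mul0r => /(_ erefl erefl) /eqP.
by rewrite addr0 add0r mulr1 oner_eq0.
Qed.

(** The linear part of x^(2^r) is lam + W mu with lam supported in P. If x^(2^r)
    is a multiple of W, then so is lam, and lam = 0 because P and its translate
    by w are disjoint. This forces X = 0 at x, and then the cofactor has
    augmentation 0. *)
Lemma multiples_are_aug_theta (theta : gT -> gT) (P : {group gT}) :
    (forall g : gT, g ^+ (2 ^ r) = theta g * w ^+ (X g && Y g))%g ->
    (forall g, theta g \in P) -> (w \notin P)%g ->
    (forall g h, theta g = theta h -> X g = X h) ->
  multiples_are_aug 2 gT N (2 ^ r).
Proof.
move=> thetaE thetaP wP thetaX x x0 /comm_pow_multipleP[d].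
have [s [-> qs]] := pow_r x.
pose lam := \sum_g x g *: gelt (theta g).
pose mu := \sum_g (x g * (X g && Y g)%:R) *: gelt (theta g).
have -> : upow r x = lam + W * mu.
  rewrite /upow /lam /mu big_distrr -big_split; apply: eq_bigr => g _ /=.
  rewrite thetaE geltM w_bool mulrDr mulr1 scalerDr -scalerAr -scalerA; congr (_ + _).
  rewrite -!scalerAr; congr (_ *: (_ *: _)).
  by rewrite mulrBl mulrBr mul1r mulr1 -!geltM (c2_centX D).
rewrite -addrA -mulrDr => e.
have lamW : lam = W * (d - (mu + s)) by rewrite mulrBr -e addrK.
have lam_out g : g \notin P -> lam g = 0.
  move=> gP; rewrite sum_ffunE big1 // => h _; rewrite !ffunE.
  by case: eqP => [eg|]; rewrite ?mulr0 //; rewrite eg thetaP in gP.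
have lam0 : lam = 0.
  apply/ffunP=> g; rewrite [RHS]ffunE; have [gP|/lam_out //] := boolP (g \in P).
  have : lam (w * g)%g = 0 by apply: lam_out; rewrite groupMr.
  have [ww _] := w_order2; rewrite lamW !W_mulE mulgA ww mul1g => e1.
  by apply/eqP; rewrite -oppr_eq0 opprB; apply/eqP.
have fib y : \sum_(g | theta g == y) x g = 0.
  have := congr1 (fun l : A => l y) lam0; rewrite sum_ffunE ffunE => e0.
  rewrite -[RHS]e0 [LHS]big_mkcond; apply: eq_bigr => g _; rewrite !ffunE eq_sym.
  by case: eqP; rewrite ?mulr1 ?mulr0.
have X0 : eX x = 0.
  rewrite /extend (partition_big theta xpredT) //= big1 // => y _.
  have [h /= /eqP hy|none] := pickP (fun g => theta g == y); last by rewrite big_pred0.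
  rewrite (eq_bigr (fun g => x g * (X h)%:R)); first by rewrite -big_distrl /= fib mul0r.
  by move=> g /eqP gy; rewrite (thetaX g h) ?gy ?hy.
rewrite lam0 add0r; apply/aug_multiple_W; rewrite linearD /= qs X0 mul0r add0r.
have -> : aug mu = eXY x.
  rewrite linear_sum /= [RHS](_ : _ = \sum_g x g * (X g && Y g)%:R) //.
  apply: eq_bigr => g _.
  by rewrite linearZ /= aug_gelt mulr1.
exact: add2.
Qed.

End Exceptional.

Section ExceptionalPairs.

Variables (r : nat) (gT : finGroupType).
Hypothesis r_gt0 : (0 < r)%N.
Local Notation N := (2 ^ r.-1)%N.

Let two_pr : prime 2 := isT.
Let two_gt0 : (0 < 2)%N. Proof. by []. Qed.

Lemma w_odd m i j (a b : gT) k : class2_pair 2 m r r i j a b ->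
  ([~ a, b] ^+ (N * k) = ([~ a, b] ^+ N) ^+ odd k)%g.
Proof.
move=> D; have [ww _] := w_order2 r_gt0 D.
have w2 : (([~ a, b] ^+ N) ^+ 2 = 1)%g by rewrite expgS expg1.
by rewrite expgM -(expg_mod k w2) modn2.
Qed.

Lemma trivial_powers_aug_multiples m (a b : gT) : (r < m)%N ->
  class2_pair 2 m r r (2 ^ r) (2 ^ r) a b -> multiples_are_aug 2 gT N (2 ^ r).
Proof.
move=> lt_rm D; have [X [Y XY]] := c2_parity r_gt0 (ltnW lt_rm) D.
have [ww w1] := w_order2 r_gt0 D.
set w := ([~ a, b] ^+ N)%g in ww w1.
have wX (e : bool) : (w ^+ e * w ^+ e = 1)%g by case: e; rewrite ?expg1 // expg0 mulg1.
pose theta g := (g ^+ (2 ^ r) * w ^+ (X g && Y g))%g.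
have thetaE x y k : theta (a ^+ x * b ^+ y * [~ a, b] ^+ k)%g = (a ^+ (2 ^ r * x))%g.
  rewrite /theta (c2_pow2 r_gt0 (ltnW lt_rm) D) (w_odd _ D) oddM -/w.
  have [-> ->] := XY x y k; rewrite [(b ^+ _)%g]expgM (c2_powb D) (c2_exp D) expg1n mulg1.
  by rewrite -mulgA wX mulg1.
have am : (a ^+ (2 ^ m) = 1)%g by rewrite (c2_powa D) (c2_exp D).
apply: (multiples_are_aug_theta r_gt0 D XY (theta := theta) (P := <[a ^+ (2 ^ r)]>%G)).
- by move=> g; rewrite /theta -mulgA wX mulg1.
- move=> g; have [x [y [k ->]]] := c2_normal_form two_gt0 D g.
  by rewrite thetaE expgM mem_cycle.
- apply/negP=> /cycleP[k]; rewrite -expgM => wk.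
  have [] := @c2_dvd _ _ _ _ _ _ _ _ _ two_gt0 D (2 ^ r * k) 0 N.
    by rewrite expg0 mulg1 -wk.
  by case/dvdnP=> q ek _; rewrite /w wk ek mulnC expgM am expg1n eqxx in w1.
move=> g h; have [x [y [k eg]]] := c2_normal_form two_gt0 D g.
have [x' [y' [k' eh]]] := c2_normal_form two_gt0 D h.
rewrite {1}eg {1}eh !thetaE => e.
have [] := @c2_normal_form_mod _ _ _ _ _ _ _ _ _ two_gt0 D (2 ^ r * x) 0 0 (2 ^ r * x') 0 0.
  by rewrite !expg0 !mulg1.
rewrite eg eh; have [-> _] := XY x y k; have [-> _] := XY x' y' k'.
move=> /(congr1 (fun u => u %% 2 ^ r.+1))%N.
rewrite !modn_dvdm ?dvdn_exp2l // expnSr -!muln_modr => /eqP.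
by rewrite eqn_pmul2l ?expn_gt0 // !modn2; case: (odd x); case: (odd x').
Qed.

Lemma twisted_powers_not_aug_multiples m i (a b : gT) :
  class2_pair 2 m r r i N a b -> ~ multiples_are_aug 2 gT N (2 ^ r).
Proof.
by move=> D; apply: (not_multiples_are_aug r_gt0 D); apply: c2_powb D.
Qed.

Lemma dihedral_not_additive (a b : gT) :
  class2_pair 2 r r r (2 ^ r) (2 ^ r) a b -> ~ aug_multiples_additive 2 gT N (2 ^ r).
Proof.
move=> D; have [X [Y XY]] := c2_parity r_gt0 (leqnn r) D.
apply: (not_additive_dihedral r_gt0 D XY) => g.
have [x [y [k eg]]] := c2_normal_form two_gt0 D g.
have [Xg Yg] := XY x y k; rewrite -eg in Xg Yg.
rewrite Xg Yg eg (c2_pow2 r_gt0 (leqnn r) D) [(a ^+ _)%g]expgM [(b ^+ _)%g]expgM.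
by rewrite (c2_powa D) (c2_powb D) (c2_exp D) !expg1n !mul1g (w_odd _ D) oddM.
Qed.

Lemma quaternion_additive (a b : gT) :
  class2_pair 2 r r r N N a b -> aug_multiples_additive 2 gT N (2 ^ r).
Proof.
move=> D; have [X [Y XY]] := c2_parity r_gt0 (leqnn r) D.
apply: (additive_quaternion r_gt0 D XY) => g.
have [x [y [k eg]]] := c2_normal_form two_gt0 D g.
have [Xg Yg] := XY x y k; rewrite -eg in Xg Yg.
rewrite Xg Yg eg (c2_pow2 r_gt0 (leqnn r) D) [(a ^+ _)%g]expgM [(b ^+ _)%g]expgM.
rewrite (c2_powa D) (c2_powb D) -!expgM -!expgD -!mulnDr (w_odd _ D) !oddD oddM.
by rewrite [RHS]expgM; case: (odd x); case: (odd y).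
Qed.

End ExceptionalPairs.

(** * The isomorphism theorem *)

Section InvariantTransfer.

Variables (p : nat) (gT hT : finGroupType).
Hypotheses (p_pr : prime p) (pG : p.-group [set: gT]%g) (pH : p.-group [set: hT]%g).
Local Notation A := (galg 'F_p gT).
Local Notation B := (galg 'F_p hT).
Variables (f : {lrmorphism A -> B}) (f' : {lrmorphism B -> A}).
Hypotheses (fK : cancel f f') (f'K : cancel f' f).

Lemma exponent_transfer k :
  (forall g : gT, g ^+ (p ^ k) = 1)%g -> (forall h : hT, h ^+ (p ^ k) = 1)%g.
Proof.
move/(trace_null_exponent gT p_pr k) => null; apply/(trace_null_exponent hT p_pr k) => y y0.
rewrite -(f'K y); apply: trace_null_image; apply: null.
by rewrite (aug_lrmorphism p_pr pH).
Qed.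

Lemma comm_null_transfer N M k :
  (forall x : A, comm_null N k x -> comm_null M k x) ->
  (forall y : B, comm_null N k y -> comm_null M k y).
Proof.
move=> null y ny; rewrite -(f'K y); apply/comm_null_image/null.
exact: comm_null_image.
Qed.

Lemma comm_pow_multiple_image N y :
  comm_pow_multiple N y -> comm_pow_multiple N (f y).
Proof.
case=> t [x [x' [d ->]]]; exists (f t), (f x), (f x'), (f d).
by rewrite !(rmorphM, rmorphXn, rmorphB).
Qed.

Lemma comm_pow_aug_multiple_image N y :
  comm_pow_aug_multiple N y -> comm_pow_aug_multiple N (f y).
Proof.
case=> t [x [x' [d [d0 ->]]]]; exists (f t), (f x), (f x'), (f d).
by split; [rewrite (aug_lrmorphism p_pr pG) | rewrite !(rmorphM, rmorphXn, rmorphB)].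
Qed.

End InvariantTransfer.

Section CommutatorPowerTransfer.

Variables (p : nat) (gT hT : finGroupType).
Hypotheses (p_pr : prime p) (pG : p.-group [set: gT]%g) (pH : p.-group [set: hT]%g).
Local Notation A := (galg 'F_p gT).
Local Notation B := (galg 'F_p hT).
Variables (f : {lrmorphism A -> B}) (f' : {lrmorphism B -> A}).
Hypotheses (fK : cancel f f') (f'K : cancel f' f).

Lemma multiples_are_aug_transfer N k :
  multiples_are_aug p gT N k -> multiples_are_aug p hT N k.
Proof.
move=> h y y0 ym; rewrite -(f'K y) -rmorphXn.
apply: (comm_pow_aug_multiple_image p_pr pG); apply: h.
  by rewrite (aug_lrmorphism p_pr pH).
by rewrite -rmorphXn; apply: comm_pow_multiple_image.
Qed.

Lemma aug_multiples_additive_transfer N k :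
  aug_multiples_additive p gT N k -> aug_multiples_additive p hT N k.
Proof.
move=> h y1 y2 y10 y20 m1 m2; rewrite -(f'K (y1 + y2)) -rmorphXn rmorphD.
apply: (comm_pow_aug_multiple_image p_pr pG); apply: h.
- by rewrite (aug_lrmorphism p_pr pH).
- by rewrite (aug_lrmorphism p_pr pH).
- by rewrite -(rmorphXn f'); apply: (comm_pow_aug_multiple_image p_pr pH).
by rewrite -(rmorphXn f'); apply: (comm_pow_aug_multiple_image p_pr pH).
Qed.

End CommutatorPowerTransfer.

Lemma pair_comm_null p m n r s t (gT : finGroupType) l : prime p -> (n <= m)%N -> (r <= n)%N ->
    (l <= r)%N -> (p ^ l %| 'C(p ^ n, 2))%N -> has_pair p m n r (p ^ s) (p ^ t) gT ->
  (forall x : galg 'F_p gT, comm_null 1 n x -> comm_null (p ^ l) n x) <->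
  ((l <= s) && (l <= t))%N.
Proof.
move=> p_pr le_nm le_rn le_lr dvd_l [a [b D]].
apply: iff_trans (comm_null_power_sep p_pr D l le_rn) _.
exact: c2_power_sep p_pr le_nm le_rn D l le_lr dvd_l.
Qed.

Lemma pair_exponent p m n r s t (gT : finGroupType) k : prime p -> (n <= m)%N -> (r <= n)%N ->
    (m <= k)%N -> (p ^ r %| 'C(p ^ k, 2))%N -> has_pair p m n r (p ^ s) (p ^ t) gT ->
  (forall g : gT, g ^+ (p ^ k) = 1)%g <-> ((m + r <= k + s) && (n + r <= k + t))%N.
Proof.
move=> p_pr le_nm le_rn le_mk dvd_k [a [b D]].
exact: c2_exponent p_pr le_nm le_rn D k le_mk dvd_k.
Qed.

Lemma bool_eq_iff (b1 b2 : bool) (P1 P2 : Prop) :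
  (P1 <-> b1) -> (P2 <-> b2) -> (P1 -> P2) -> (P2 -> P1) -> b1 = b2.
Proof. by move=> e1 e2 h1 h2; apply/idP/idP => [/e1/h1/e2|/e2/h2/e1]. Qed.

Section Main.

Variables (p : nat) (gT hT : finGroupType).
Hypotheses (p_pr : prime p) (pG : p.-group [set: gT]%g) (pH : p.-group [set: hT]%g).
Variables (f : {lrmorphism galg 'F_p gT -> galg 'F_p hT}).
Variables (f' : {lrmorphism galg 'F_p hT -> galg 'F_p gT}).
Hypotheses (fK : cancel f f') (f'K : cancel f' f).
Variables (m n r : nat).
Hypotheses (le_nm : (n <= m)%N) (le_rn : (r <= n)%N).

(** The exponent and the separation of p^n-th powers recover s and t, with min
    (s, t) known only up to l0 = r - 1 if p = 2 and n = r > 0. *)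
Lemma pairs_isog_generic i j i' j' : [|| odd p, (r < m)%N | r == 0%N] ->
    has_pair p m n r i j gT -> has_pair p m n r i' j' hT ->
  ([set: gT] \isog [set: hT])%g.
Proof.
move=> reg PG PH; have p_gt0 := prime_gt0 p_pr.
have [s [t [Nst {}PG]]] := has_pair_normal p_pr le_nm le_rn reg PG.
have [s' [t' [Nst' {}PH]]] := has_pair_normal p_pr le_nm le_rn reg PH.
pose l0 := if [|| odd p, (r < n)%N | r == 0%N] then r else r.-1.
have l0_le : (r.-1 <= l0 <= r)%N by rewrite /l0; case: ifP; rewrite leqnn leq_pred.
have exp_eq k : (m <= k)%N ->
    ((m + r <= k + s) && (n + r <= k + t) = (m + r <= k + s') && (n + r <= k + t'))%N.
  move=> le_mk; have dvd_k : (p ^ r %| 'C(p ^ k, 2))%N.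
    apply: bin2_pow_dvd => //; first by rewrite (leq_trans le_rn) ?(leq_trans le_nm).
    by case/or3P: reg => [->|lt_rm|->]; rewrite ?orbT // (leq_trans lt_rm) ?orbT.
  apply: bool_eq_iff (pair_exponent p_pr le_nm le_rn le_mk dvd_k PG)
    (pair_exponent p_pr le_nm le_rn le_mk dvd_k PH) _ _.
    exact: exponent_transfer p_pr pH f f' f'K k.
  exact: exponent_transfer p_pr pG f' f fK k.
have sep_eq l : (l <= l0)%N -> ((l <= s) && (l <= t) = (l <= s') && (l <= t'))%N.
  move=> le_l; have le_lr : (l <= r)%N by case/andP: l0_le => _; apply: leq_trans.
  have dvd_l : (p ^ l %| 'C(p ^ n, 2))%N.
    apply: bin2_pow_dvd => //; first exact: leq_trans le_rn.
    move: le_l; rewrite /l0; case: ifP => [/or3P[->//|lt_rn|/eqP r0] _|/negbT].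
    - by rewrite (leq_ltn_trans le_lr lt_rn) orbT.
    - by move: le_lr; rewrite r0 leqn0 => ->; rewrite !orbT.
    rewrite !negb_or -lt0n => /and3P[_ _ r_gt0] le_l; rewrite (leq_trans _ le_rn) ?orbT //.
    by rewrite -(prednK r_gt0) ltnS.
  apply: bool_eq_iff (pair_comm_null p_pr le_nm le_rn le_lr dvd_l PG)
    (pair_comm_null p_pr le_nm le_rn le_lr dvd_l PH) _ _.
    exact: comm_null_transfer f f' f'K _ _ _.
  exact: comm_null_transfer f' f fK _ _ _.
have := normal_exps_inj le_nm l0_le Nst Nst' exp_eq sep_eq.
case=> [[es et] | [lt_l0 lt_nm es es' ets]].
  by rewrite -es -et in PH; apply: has_pair_isog PG PH.
have irr : ~~ [|| odd p, (r < n)%N | r == 0%N].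
  by apply: contraL lt_l0 => irr; rewrite /l0 irr ltnn.
move: irr; rewrite !negb_or -lt0n -leqNgt => /and3P[odd_p le_nr r_gt0].
have p2 : p = 2 by case: (even_prime p_pr) odd_p => // ->.
have nr : n = r by apply/eqP; rewrite eqn_leq le_nr le_rn.
subst s s'; move: f f' fK f'K pG pH; subst p n => F F' FK F'K p2G p2H.
case: ets => [[et et'] | [et et']]; subst t t'.
  case: PG => [a [b D]]; case: PH => [a' [b' D']].
  case: (twisted_powers_not_aug_multiples r_gt0 D').
  apply: (multiples_are_aug_transfer _ p2G p2H F'K) => //.
  apply: (trivial_powers_aug_multiples r_gt0 lt_nm D).
case: PG => [a [b D]]; case: PH => [a' [b' D']].
case: (twisted_powers_not_aug_multiples r_gt0 D).
apply: (multiples_are_aug_transfer _ p2H p2G FK) => //.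
apply: (trivial_powers_aug_multiples r_gt0 lt_nm D').
Qed.

Lemma pairs_isog_exceptional i j i' j' : ~~ [|| odd p, (r < m)%N | r == 0%N] ->
    has_pair p m n r i j gT -> has_pair p m n r i' j' hT ->
  ([set: gT] \isog [set: hT])%g.
Proof.
rewrite !negb_or -lt0n -leqNgt => /and3P[odd_p le_mr r_gt0] PG PH.
have p2 : p = 2 by case: (even_prime p_pr) odd_p => // ->.
have nr : n = r by apply/eqP; rewrite eqn_leq le_rn (leq_trans le_nm).
have mr : m = r by apply/eqP; rewrite eqn_leq le_mr (leq_trans le_rn).
move: f f' fK f'K pG pH PG PH; clear odd_p le_mr; subst p; move: le_nm le_rn; subst m n.
move=> _ _ F F' FK F'K p2G p2H PG PH.
have rr := leqnn r; have two_pr : prime 2 by [].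
have sep_eq s t s' t' l : (l < r)%N -> has_pair 2 r r r (2 ^ s) (2 ^ t) gT ->
    has_pair 2 r r r (2 ^ s') (2 ^ t') hT ->
    ((l <= s) && (l <= t) = (l <= s') && (l <= t'))%N.
  move=> lt_lr QG QH; have le_lr := ltnW lt_lr.
  have dvd_l : (2 ^ l %| 'C(2 ^ r, 2))%N by apply: bin2_pow_dvd; rewrite ?lt_lr.
  apply: bool_eq_iff (pair_comm_null two_pr rr rr le_lr dvd_l QG)
    (pair_comm_null two_pr rr rr le_lr dvd_l QH) _ _.
    exact: comm_null_transfer F F' F'K _ _ _.
  exact: comm_null_transfer F' F FK _ _ _.
have lt_pred : (r.-1 < r)%N by rewrite prednK.
have small s : (s.+1 < r)%N -> (r.-1 <= s)%N = false.
  by move=> lt_s; rewrite leqNgt -ltnS prednK // lt_s.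
have dq : forall xT yT : finGroupType, has_pair 2 r r r (2 ^ r) (2 ^ r) xT ->
    has_pair 2 r r r (2 ^ r.-1) (2 ^ r.-1) yT ->
    ~ (aug_multiples_additive 2 yT (2 ^ r.-1) (2 ^ r) ->
       aug_multiples_additive 2 xT (2 ^ r.-1) (2 ^ r)).
  move=> xT yT [a [b D]] [a' [b' D']] h; apply: (dihedral_not_additive r_gt0 D).
  exact/h/(quaternion_additive r_gt0 D').
case: (exceptional_normal r_gt0 PG) => [[s lt_s]||] QG;
  case: (exceptional_normal r_gt0 PH) => [[s' lt_s']||] QH.
- have le_sr : (s <= r)%N by rewrite ltnW ?(ltnW lt_s).
  have le_sr' : (s' <= r)%N by rewrite ltnW ?(ltnW lt_s').
  have := sep_eq _ _ _ _ s' (ltnW lt_s') QG QH; have := sep_eq _ _ _ _ s (ltnW lt_s) QG QH.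
  rewrite !leqnn le_sr le_sr' !andbT => le1 le2.
  have es : s = s' by apply/eqP; rewrite eqn_leq le2 -le1.
  by rewrite -es in QH; apply: has_pair_isog QG QH.
- by have := sep_eq _ _ _ _ r.-1 lt_pred QG QH; rewrite leq_pred small.
- by have := sep_eq _ _ _ _ r.-1 lt_pred QG QH; rewrite leqnn small.
- by have := sep_eq _ _ _ _ r.-1 lt_pred QG QH; rewrite leq_pred small.
- exact: has_pair_isog QG QH.
- by case: (dq _ _ QG QH); apply: (aug_multiples_additive_transfer two_pr p2H p2G FK).
- by have := sep_eq _ _ _ _ r.-1 lt_pred QG QH; rewrite leqnn small.
- by case: (dq _ _ QH QG); apply: (aug_multiples_additive_transfer two_pr p2G p2H F'K).
exact: has_pair_isog QG QH.
Qed.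

End Main.

Lemma class2_galg_isog (p : nat) (gT hT : finGroupType) : prime p ->
    p.-group [set: gT]%g -> p.-group [set: hT]%g ->
    alg_isomorphic (galg 'F_p gT) (galg 'F_p hT) ->
    two_generated [set: gT] -> (nil_class [set: gT] <= 2)%N ->
  ([set: gT] \isog [set: hT])%g.
Proof.
move=> p_pr pG pH [f /lrmorphism_inverse[f' [fK f'K]]] [x [y genG]] cl2.
have sG'Z : ([set: gT]^`(1) \subset 'Z([set: gT]))%g.
  by rewrite -nil_class2 ?(pgroup_nil pG).
have rQ : ('r([set: gT] / [set: gT]^`(1))%g <= 2)%N.
  rewrite -grank_abelian ?der_abelian //.
  have nG' (A : {set gT}) : A \subset 'N([set: gT]^`(1))%g.
    exact: subset_trans (subsetT A) (der_norm 1 _).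
  have : (<<[set x; y]>> / [set: gT]^`(1) = <<[set x; y] / [set: gT]^`(1)>>)%g.
    exact: quotient_gen.
  rewrite -genG => /= ->; apply: leq_trans (grank_min _) _.
  apply: leq_trans (leq_morphim _ _) _.
  by rewrite cards2; case: (_ != _).
have [m [n [r [i [j [a [b [le_nm le_rn DG cardQ expQ]]]]]]]] :=
  class2_pair_exists p_pr pG sG'Z rQ.
have cardG' : #|[set: gT]^`(1)%g| = (p ^ r)%N.
  apply/eqP; rewrite -(eqn_pmul2r (cardG_gt0 ([set: gT] / [set: gT]^`(1))%G)) /=.
  rewrite {1}card_quotient ?der_norm // Lagrange ?der_sub // (c2_card DG) cardQ.
  by rewrite -!expnD addnC.
have sH'Z : ([set: hT]^`(1) \subset 'Z([set: hT]))%g.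
  apply: (iso_class2 p_pr pH fK f'K (c := [~ a, b]%g) (r := r)) => //.
  - exact: c2_cent DG.
  - by rewrite mem_commg ?inE.
  exact: c2_order DG.
have rQH : ('r([set: hT] / [set: hT]^`(1))%g <= 2)%N.
  by rewrite -(iso_rank_der_quotient p_pr pG pH fK f'K).
have [m' [n' [r' [i' [j' [a' [b' [le_nm' le_rn' DH cardQ' expQ']]]]]]]] :=
  class2_pair_exists p_pr pH sH'Z rQH.
have em : m' = m.
  apply/eqP; rewrite eqn_leq; apply/andP; split.
    apply/(expQ' m).1; apply: (iso_exponent_der_quotient p_pr fK f'K).
    exact/expQ.
  apply/(expQ m').1; apply: (iso_exponent_der_quotient p_pr f'K fK).
  exact/expQ'.
have en : n' = n.
  have := iso_card_der_quotient p_pr fK f'K; rewrite cardQ cardQ' em => /eqP.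
  by rewrite eqn_exp2l ?prime_gt1 // eqn_add2l => /eqP.
have er : r' = r.
  have := iso_card p_pr fK f'K; rewrite (c2_card DG) (c2_card DH) em en => /eqP.
  by rewrite eqn_pmul2l ?muln_gt0 ?expn_gt0 ?prime_gt0 // eqn_exp2l ?prime_gt1 // => /eqP.
rewrite em en er in DH.
have PG : has_pair p m n r i j gT by exists a, b.
have PH : has_pair p m n r i' j' hT by exists a', b'.
have [reg|irr] := boolP [|| odd p, (r < m)%N | r == 0%N].
  exact: (pairs_isog_generic p_pr pG pH fK f'K le_nm le_rn reg PG PH).
exact: (pairs_isog_exceptional p_pr pG pH fK f'K le_nm le_rn irr PG PH).
Qed.

Local Close Scope ring_scope.
Local Close Scope group_scope.

Theorem theorem0p1 (p : nat) (gT hT : finGroupType)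
    (G : {group gT}) (H : {group hT}) (p_prime : prime p)
    (pG : (p.-group G)%g) (pH : (p.-group H)%g)
    (FG_iso_FH : alg_isomorphic (galg 'F_p (subg_of G)) (galg 'F_p (subg_of H)))
    (G_2gen : two_generated G) (G_class2 : nil_class G <= 2) :
  (G \isog H)%g.
Proof.
have isoG := isog_subg G; have isoH := isog_subg H.
rewrite (isog_transl _ isoG) isog_sym (isog_transl _ isoH) isog_sym.
apply: (class2_galg_isog p_prime) => //.
- by rewrite -(isog_pgroup p isoG).
- by rewrite -(isog_pgroup p isoH).
- have [x [y genG]] := G_2gen; exists (subg G x), (subg G y).
  have sxyG : [set x; y] \subset G by rewrite genG subset_gen.
  have : (subg G @* <<[set x; y]>> = <<[set subg G x; subg G y]>>)%g.
    by rewrite morphim_gen // morphimEsub // imsetU1 imset_set1.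
  by rewrite -genG im_subg.
by rewrite -(isog_nil_class isoG).
Qed.
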